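(* Let $n\ge2$, let $\pi,\rho\in\mathfrak{S}_n^0$ and $\lambda,\mu\in\mathbb{R}_+^n$ be such that $T=\mathcal{I}_{\pi,\lambda}$ and $S=\mathcal{I}_{\rho,\mu}$ are i.d.o.c. interval exchange transformations. Suppose that $B_1,B_2,B_3,\dots$ are the visitation matrices defined by an admissible induction sequence for $T$, and that the same sequence $B_1,B_2,B_3,\dots$ is also the sequence of visitation matrices defined by an admissible induction sequence for $S$. Then $\pi=\rho$. That is, visitation matrices defined by an admissible induction sequence determine the initial permutation uniquely.
   Context: $\mathfrak{S}_n^0$ is the set of irreducible permutations of $\{1,\dots,n\}$: permutations $\pi$ such that, for $1\le k\le n$, $\pi\{1,\dots,k\}=\{1,\dots,k\}$ iff $k=n$. $\mathbb{R}_+^n$ is the set of vectors with all entries positive. Intervals and sub-intervals are of the form $[a,b)$ with $a<b$. $\mathbb{N}=\{1,2,\dots\}$. For $\pi\in\mathfrak{S}_n^0$, $\lambda\in\mathbb{R}_+^n$ let $\beta_j=\sum_{i\le j}\lambda_i$ ($0\le j\le n$), $I=[0,\beta_n)$, $I_j=[\beta_{j-1},\beta_j)$. The interval exchange transformation ($n$-IET) $T=\mathcal{I}_{\pi,\lambda}:I\to I$ is $T(x)=x+\omega_j$ for $x\in I_j$, where $\omega_j=\sum_{\pi(i)<\pi(j)}\lambda_i-\sum_{k<j}\lambda_k$. It is i.d.o.c. (infinite distinct orbit condition) iff the orbits $\{T^k\beta_j:k\in\mathbb{Z}\}$, $1\le j<n$, are infinite and pairwise distinct. An IET may also be considered on a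 translate of $[0,\beta_n)$, by conjugating by the translation. Admissibility: let $T$ be an i.d.o.c. $n$-IET on $I$ with exchanged intervals $I_1,\dots,I_n$. For a sub-interval $I'\subseteq I$ and $x\in I'$ let $r(x)=\min\{k\in\mathbb{N}:T^kx\in I'\}$; the induced transformation is $T|_{I'}(x)=T^{r(x)}(x)$. The sub-interval $I'$ is admissible for $T$ if there is a partition of $I'$ into $n$ consecutive sub-intervals $I'_1,\dots,I'_n$ such that for each $1\le i\le n$: (1) $r$ is constant on $I'_i$, with value denoted $r_i$; (2) for each $0\le k<r_i$, $T$ restricted to $T^kI'_i$ is a translation; (3) for each $0\le k<r_i$, $T^kI'_i\subseteq I_j$ for some $1\le j\le n$. The $n\times n$ visitation matrix is $A_{ij}=\#\{0\le k<r_j:T^kI'_j\subseteq I_i\}$. In this case $T|_{I'}$ is again an i.d.o.c. $n$-IET, with exchanged intervals $I'_1,\dots,I'_n$. An admissible induction sequence for $T:I\to I$ is an infinite sequence of sub-intervals $I=I^{(0)}\supsetneq I^{(1)}\supsetneq I^{(2)}\supsetneq\cdots$ such that, with $T^{(0)}=T$ and $T^{(k)}=T^{(k-1)}|_{I^{(k)}}$, the interval $I^{(k)}$ is admissible for $T^{(k-1)}$ on $I^{(k-1)}$ (with exchanged intervals those given by the admissibility partition of the previous step) for every $k\ge1$. The visitation matrices it defines are $B_k$ = the visitation matrix of the induction of $T^{(k-1)}$ on $I^{(k)}$. *)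

(* Defs.v *)
From mathcomp Require Import all_boot all_order all_algebra all_fingroup.
From mathcomp Require Import all_classical all_reals.

Set Implicit Arguments.
Unset Strict Implicit.
Unset Printing Implicit Defensive.

Import Order.TTheory GRing.Theory Num.Theory.
Local Open Scope classical_set_scope.
Local Open Scope ring_scope.

(* Permutations of {1, .., n} are permutations of 'I_n = {0, .., n.-1}, so that
   {1, .., k} becomes [set i : 'I_n | i < k]. *)
Definition irreducible_perm (n : nat) (pi : 'S_n) : Prop :=
  forall k : nat, (1 <= k <= n)%N ->
    (pi @` [set i : 'I_n | (i < k)%N] = [set i : 'I_n | (i < k)%N] <-> k = n).

Definition positive_vector (R : realType) (n : nat) (lam : 'rV[R]_n) : Prop :=
  forall i : 'I_n, 0 < lam 0 i.

(* A partition of an interval [a, b) into n consecutive intervals is encoded by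
   its left endpoint a and the vector lam of the lengths of the pieces. *)
Definition endpoint (R : realType) (n : nat) (a : R) (lam : 'rV[R]_n)
    (j : nat) : R :=
  a + \sum_(i < n | (i < j)%N) lam 0 i.

Definition piece (R : realType) (n : nat) (a : R) (lam : 'rV[R]_n)
    (j : 'I_n) : set R :=
  [set` `[endpoint a lam j, endpoint a lam j.+1[].

Definition hull (R : realType) (n : nat) (a : R) (lam : 'rV[R]_n) : set R :=
  [set` `[a, endpoint a lam n[].

Definition partitions (R : realType) (n : nat) (J : set R) (a : R)
    (lam : 'rV[R]_n) : Prop :=
  positive_vector lam /\ J = hull a lam.

Definition iet_shift (R : realType) (n : nat) (pi : 'S_n) (lam : 'rV[R]_n)
    (j : 'I_n) : R :=
  \sum_(i < n | (pi i < pi j)%N) lam 0 i - \sum_(k < n | (k < j)%N) lam 0 k.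

(* Maps defined on an interval are represented by total functions on R; only
   their values on that interval matter. Here the value outside of
   hull 0 lam is the junk value x. *)
Definition iet (R : realType) (n : nat) (pi : 'S_n) (lam : 'rV[R]_n)
    (x : R) : R :=
  if [pick j : 'I_n | x \in `[endpoint 0 lam j, endpoint 0 lam j.+1[]
  is Some j then x + iet_shift pi lam j else x.

(* The two-sided orbit {T^k x : k in Z} of a bijection T : I -> I; for k = -m
   with m >= 0, the equation y = T^k x is written T^m y = x. *)
Definition orbit (R : realType) (I : set R) (T : R -> R) (x : R) : set R :=
  [set y | I y /\ exists m : nat, y = iter m T x \/ iter m T y = x].

(* An index j : 'I_n with 0 < j ranges over 1 <= j < n. *)
Definition idoc (R : realType) (n : nat) (pi : 'S_n) (lam : 'rV[R]_n) : Prop :=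
  let orb (j : 'I_n) :=
    orbit (hull 0 lam) (iet pi lam) (endpoint 0 lam j) in
  (forall j : 'I_n, (0 < j)%N -> infinite_set (orb j)) /\
  (forall i j : 'I_n, (0 < i)%N -> (0 < j)%N -> i <> j -> orb i <> orb j).

Definition is_return_time (R : realType) (T : R -> R) (J : set R) (x : R)
    (k : nat) : Prop :=
  [/\ (0 < k)%N, J (iter k T x) &
      forall m : nat, (0 < m < k)%N -> ~ J (iter m T x)].

(* The junk value when x never returns to J is unspecified. *)
Definition return_time (R : realType) (T : R -> R) (J : set R) (x : R) : nat :=
  get (is_return_time T J x).

Definition induced (R : realType) (T : R -> R) (J : set R) (x : R) : R :=
  iter (return_time T J x) T x.

Definition translation_on (R : realType) (A : set R) (T : R -> R) : Prop :=
  exists w : R, forall y : R, A y -> T y = y + w.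

(* The partition (a', lam') of J, with return times r, witnesses that J is
   admissible for T, whose exchanged intervals are the pieces of (a, lam). *)
Definition admissible_by (R : realType) (n : nat) (T : R -> R)
    (a : R) (lam : 'rV[R]_n) (J : set R)
    (a' : R) (lam' : 'rV[R]_n) (r : 'I_n -> nat) : Prop :=
  [/\ J `<=` hull a lam, partitions J a' lam' &
    forall i : 'I_n,
      [/\ forall x : R, piece a' lam' i x -> is_return_time T J x (r i),
          forall k : nat, (k < r i)%N ->
            translation_on (iter k T @` piece a' lam' i) T &
          forall k : nat, (k < r i)%N ->
            exists j : 'I_n, iter k T @` piece a' lam' i `<=` piece a lam j]].

Definition visitation_matrix (R : realType) (n : nat) (T : R -> R)
    (a : R) (lam : 'rV[R]_n) (a' : R) (lam' : 'rV[R]_n) (r : 'I_n -> nat) :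
    'M[nat]_n :=
  \matrix_(i < n, j < n)
    #|[pred k : 'I_(r j) |
        `[< iter k T @` piece a' lam' j `<=` piece a lam i >]]|.

Fixpoint iterated_induced (R : realType) (T : R -> R) (J : nat -> set R)
    (k : nat) : R -> R :=
  if k is k'.+1 then induced (iterated_induced T J k') (J k) else T.

(* J is an admissible induction sequence for T, whose exchanged intervals are
   the pieces of (a 0, lam 0); for each k >= 1 the partition (a k, lam k) of
   J k is the one given by admissibility, with return times r k. *)
Definition admissible_induction_sequence (R : realType) (n : nat) (T : R -> R)
    (J : nat -> set R) (a : nat -> R) (lam : nat -> 'rV[R]_n)
    (r : nat -> 'I_n -> nat) : Prop :=
  [/\ J 0%N = hull (a 0%N) (lam 0%N),
      forall k : nat, J k.+1 `<` J k &
      forall k : nat,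
        admissible_by (iterated_induced T J k) (a k) (lam k)
          (J k.+1) (a k.+1) (lam k.+1) (r k.+1)].

(* The matrices are indexed from 1: B 0 is irrelevant. *)
Definition defines_visitation_matrices (R : realType) (n : nat)
    (pi : 'S_n) (lam0 : 'rV[R]_n) (B : nat -> 'M[nat]_n) : Prop :=
  exists (J : nat -> set R) (a : nat -> R) (lam : nat -> 'rV[R]_n)
         (r : nat -> 'I_n -> nat),
    [/\ a 0%N = 0, lam 0%N = lam0,
        admissible_induction_sequence (iet pi lam0) J a lam r &
        forall k : nat,
          B k.+1 = visitation_matrix (iterated_induced (iet pi lam0) J k)
            (a k) (lam k) (a k.+1) (lam k.+1) (r k.+1)].

(* Main.v *)
Require Import Defs.
From mathcomp Require Import all_boot all_order all_algebra all_fingroup.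
From mathcomp Require Import all_classical all_reals topology normedtype.
From mathcomp Require Import zify ring lra.

(** Let T and S be the two exchanges.  For an order N of the images of the pieces let
   Omega_N be the antisymmetric matrix with entries [N k j] - [k < j]: an
   exchange with lengths v and image order N has translation vector Omega_N v,
   and Omega_N determines N ([translation_mx_inj]).  Put A_l = B_1 ... B_l.

   Over the l-th interval, T itself decomposes into towers whose visits to the
   original pieces are counted by A_l ([sequence_visits]), and the order N_l of
   the induced exchange satisfies A_l^T Omega_N A_l = Omega_(N_l)
   ([translation_mx_induced]).  There are finitely many orders, so some k < l
   have the same order at both levels, for T and for S simultaneously.  Then
   C = B_(k+1) ... B_l preserves two forms, Omega for T and Omega' for S, at
   level k.

   The orbit condition makes T minimal with uniform hitting times
   ([keane_minimal]) and makes the towers arbitrarily high, so that C may be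
   taken positive ([visit_prod_positive]).  Let v > 0 be its Perron vector,
   C v = theta v with theta > 1.  Both Omega v and Omega' v are eigenvectors of
   C^T for 1/theta.  This eigenspace is a line
   ([invariant_forms_proportional]): it has the dimension of the eigenspace of C
   for 1/theta, which Omega maps into the line of left Perron vectors,
   injectively because no kernel vector of Omega is an eigenvector for 1/theta
   ([level_kernel_no_eigenvector]).  The last fact holds because the partial sums
   of a kernel vector form a function invariant along orbits, whose values do not
   change under induction up to an additive constant ([kernel_partial_sums]).

   So Omega v and Omega' v are proportional.  They are equal, since an exchange
   preserves the integral of x^2, which puts translation vectors on a sphere
   through 0 that depends on v only ([translation_sphere]).  Equal lengths and
   translations give equal orders, so Omega = Omega' at level k.  As A_k is
   invertible ([visit_prod_unit]), the original forms are equal, and so are pi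
   and rho. *)

Set Implicit Arguments.
Unset Strict Implicit.
Unset Printing Implicit Defensive.

Import Order.TTheory GRing.Theory Num.Theory.
Import numFieldNormedType.Exports.
Local Open Scope classical_set_scope.
Local Open Scope ring_scope.

(** * Pigeonholes, minima and bounds *)

Lemma subn_succ m m' : (m < m')%N -> exists k, (m' - m = k.+1)%N.
Proof. by move=> h; exists (m' - m).-1; rewrite prednK// subn_gt0. Qed.

Lemma seq_pigeonhole (V : eqType) (s : seq V) (f : nat -> V) :
  (forall m, f m \in s) -> exists m m', (m < m')%N /\ f m = f m'.
Proof.
move=> fs; pose u := mkseq f (size s).+1.
have su : {subset u <= s} by move=> x /mapP[m _ ->].
have : ~~ uniq u.
  apply/negP => uu; have := uniq_leq_size uu su.
  by rewrite size_mkseq ltnn.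
move=> /(uniqPn (f 0%N))[m [m' [mm' m's]]].
rewrite size_mkseq in m's; rewrite !nth_mkseq//; last exact: ltn_trans m's.
by move=> e; exists m, m'.
Qed.

Lemma real_pigeonhole (R : realType) (L eta : R) (f : nat -> R) :
  (forall m, 0 <= f m < L) -> 0 < eta ->
  exists m m', (m < m')%N /\ `|f m - f m'| < eta.
Proof.
move=> fL eta0; pose g m := Num.truncn (f m / eta).
have gE m : (g m)%:R <= f m / eta < (g m).+1%:R.
  by apply: truncn_itv; rewrite divr_ge0 ?(ltW eta0)//; have /andP[] := fL m.
have [m [m' [mm' e]]] : exists m m', (m < m')%N /\ g m = g m'.
  apply: (@seq_pigeonhole _ (iota 0 (Num.truncn (L / eta)).+1)) => m.
  rewrite mem_iota add0n ltnS le_truncn// ler_pM2r ?invr_gt0//.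
  by have /andP[_ /ltW] := fL m.
exists m, m'; split=> //.
have := gE m; have := gE m'; rewrite -e -natr1.
rewrite !ler_pdivlMr// !ltr_pdivrMr// => /andP[h1 h2] /andP[h3 h4].
by rewrite ltr_norml; apply/andP; split; lra.
Qed.

Lemma seq_has_min (R : realType) (s : seq R) : s != [::] ->
  exists2 x, x \in s & forall y, y \in s -> x <= y.
Proof.
elim: s => // a [|b s] IH _.
  by exists a; rewrite ?mem_head// => y; rewrite inE => /eqP->.
have [//|x xs xm] := IH.
have [ax|xa] := leP a x.
  exists a; first exact: mem_head.
  by move=> y; rewrite inE => /orP[/eqP->//|/xm]; exact: le_trans.
exists x; first by rewrite inE xs orbT.
by move=> y; rewrite inE => /orP[/eqP->|/xm//]; exact: ltW.
Qed.

Lemma seq_bounded_witness (V : eqType) (s : seq V) (P : V -> nat -> Prop) :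
  (forall x, x \in s -> exists m, P x m) ->
  exists M, forall x, x \in s -> exists2 m, (m < M)%N & P x m.
Proof.
elim: s => [|a s IH] H; first by exists 0%N.
have [M HM] := IH (fun x xs => H x (@mem_behead _ (a :: s) x xs)).
have [m Pm] := H a (mem_head _ _).
exists (maxn M m.+1) => x; rewrite inE => /orP[/eqP->|/HM[k kM Pk]].
  by exists m => //; lia.
by exists k => //; lia.
Qed.

(** * Properties of all small nonnegative numbers *)

(** A one-sided neighbourhood of 0 that contains 0, so that the same predicate
   describes what happens to the right and to the left of a point. *)
Definition small (R : realType) (P : R -> Prop) :=
  exists2 e : R, 0 < e & forall t, 0 <= t < e -> P t.

Section Small.
Context (R : realType).
Implicit Types P Q : R -> Prop.

Lemma smallS P Q : (forall t, 0 <= t -> P t -> Q t) -> small P -> small Q.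
Proof.
by move=> PQ [e e0 eP]; exists e => // t /[dup] /andP[t0 _] /eP; exact: PQ.
Qed.

Lemma smallI P Q : small P -> small Q -> small (fun t => P t /\ Q t).
Proof.
move=> [e e0 eP] [d d0 dQ]; exists (Num.min e d); first by rewrite lt_min e0.
by move=> t; rewrite lt_min => /and3P[t0 te td]; split; [apply: eP|apply: dQ];
  rewrite t0.
Qed.

Lemma small_lt (c : R) : 0 < c -> small (fun t => t < c).
Proof. by move=> c0; exists c => // t /andP[]. Qed.

Lemma small_all (V : eqType) (s : seq V) (P : V -> R -> Prop) :
  (forall x, x \in s -> small (P x)) ->
  small (fun t => forall x, x \in s -> P x t).
Proof.
elim: s => [|a s IH] H; first by exists 1.
have sa := H a (mem_head _ _).
have ss := IH (fun x xs => H x (@mem_behead _ (a :: s) x xs)).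
apply: smallS (smallI sa ss) => t _ [Pa Ps] x.
by rewrite inE => /orP[/eqP->|/Ps].
Qed.

End Small.

(** * Minimality of exchanges without connections *)

(** The properties of an exchange with infinite distinct orbits that minimality
   rests on.  The list D holds the interior break points, and 0 is the image of
   one of them because the permutation is irreducible. *)
Record keane_map (R : realType) (L : R) (T : R -> R) (D : seq R) : Prop := KeaneMap {
  keane_dom : forall x, 0 <= x < L -> 0 <= T x < L;
  keane_inj : forall x y, 0 <= x < L -> 0 <= y < L -> T x = T y -> x = y;
  keane_surj : forall y, 0 <= y < L -> exists2 x, 0 <= x < L & T x = y;
  keane_break : forall e, e \in D -> 0 < e < L;
  keane_transl : forall x y, 0 <= x -> x <= y -> y < L ->
    (forall e, e \in D -> ~~ (x < e <= y)) -> T y = T x + (y - x);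
  keane_zero : exists2 z, z \in D & T z = 0;
  keane_no_connection : forall e e' s, e \in D -> e' \in D -> iter s.+1 T e <> e' }.

Section Keane.
Context (R : realType) (L : R) (T : R -> R) (D : seq R) (kT : keane_map L T D).

Lemma iter_dom m x : 0 <= x < L -> 0 <= iter m T x < L.
Proof. by move=> xL; elim: m => //= m; exact: (keane_dom kT). Qed.

Lemma iter_inj m x y : 0 <= x < L -> 0 <= y < L ->
  iter m T x = iter m T y -> x = y.
Proof.
move=> xL yL; elim: m => //= m IH /(keane_inj kT) e.
by apply: IH; apply: e; exact: iter_dom.
Qed.

Lemma iter_cancel m m' x y : 0 <= x < L -> 0 <= y < L -> (m <= m')%N ->
  iter m T x = iter m' T y -> x = iter (m' - m) T y.
Proof.
move=> xL yL mm' e; apply: (@iter_inj m) => //; first exact: iter_dom.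
by rewrite -iterD subnKC.
Qed.

Lemma break_dom e : e \in D -> 0 <= e < L.
Proof. by move=> /(keane_break kT)/andP[/ltW->]. Qed.

(** Shift a periodic orbit to the left, all points at the same speed, until it
   first meets a break point or 0, which is the image of a break point: this makes
   a break point periodic. *)
Lemma keane_aperiodic s x : 0 <= x < L -> iter s.+1 T x <> x.
Proof.
move=> xL per; have [z zD Tz0] := keane_zero kT.
have g0 m : 0 <= iter m T x by have /andP[] := iter_dom m xL.
have gL m : iter m T x < L by have /andP[] := iter_dom m xL.
pose ds := [seq iter m T x - e | m <- index_iota 0 s.+1, e <- 0 :: D].
pose dp := [seq d <- ds | 0 <= d].
have [|t] := @seq_has_min _ dp.
  suff : x \in dp by case: dp.
  rewrite mem_filter; apply/andP; split; first by have /andP[] := xL.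
  by apply/allpairsP; exists (0%N, 0) => /=; split; rewrite ?subr0 ?inE ?eqxx.
rewrite mem_filter => /andP[t0 /allpairsP[[m0 e0] /= [m0s e0D tE]]] tmin.
have tle m e : (m < s.+1)%N -> e \in 0 :: D -> e <= iter m T x ->
    t <= iter m T x - e.
  move=> ms eD eg; apply: tmin; rewrite mem_filter subr_ge0 eg /=.
  by apply/allpairsP; exists (m, e); split; rewrite ?mem_index_iota.
have tr m : (m <= s.+1)%N -> iter m T (x - t) = iter m T x - t.
  elim: m => // m IH ms; rewrite /= IH; last by lia.
  have tm := tle m 0 ms (mem_head _ _) (g0 m); rewrite subr0 in tm.
  have := @keane_transl _ _ _ _ kT (iter m T x - t) (iter m T x).
  move=> ->; [ring|lra|lra|exact: gL|].
  move=> e eD; apply/negP => /andP[h1 h2].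
  have := tle m e ms; rewrite inE eD orbT => /(_ isT h2); lra.
have t_x : t <= x.
  by have := tle 0%N 0 isT (mem_head _ _) (g0 0%N); rewrite subr0; exact.
have ydom : 0 <= x - t < L by have := gL 0%N => /=; lra.
have yper : iter s.+1 T (x - t) = x - t by rewrite tr// per.
have m0le : (m0 <= s.+1)%N by move: m0s; rewrite mem_index_iota => /andP[_ /ltnW].
have ye : iter m0 T (x - t) = e0 by rewrite tr// tE; ring.
have eper : iter s.+1 T e0 = e0 by rewrite -ye -iterD addnC iterD yper.
move: e0D; rewrite inE => /orP[/eqP e00|e0D]; last exact: (keane_no_connection kT e0D e0D eper).
rewrite e00 in eper; apply: (keane_no_connection kT zD zD (s := s)).
apply: (keane_inj kT); [exact/iter_dom/break_dom|exact: break_dom|].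
by rewrite -iterS iterSr Tz0.
Qed.

(** A break inside of the s-th translate of (p, y] would be the s-th iterate of a
   point of (p, x]. *)
Lemma travel p x m : 0 <= p -> x < L ->
  (forall y s, p < y <= x -> (s < m)%N -> iter s T y \notin D) ->
  forall y s, p <= y <= x -> (s <= m)%N -> iter s T y = iter s T p + (y - p).
Proof.
move=> p0 xL H y s yx; elim: s y yx => [|s IH] y yx sm; first by rewrite /=; ring.
have py : p <= y by case/andP: yx.
have e1 := IH y yx (ltnW sm).
have pL : 0 <= p < L by case/andP: yx; lra.
have yL : 0 <= y < L by case/andP: yx; lra.
have /andP[g0 _] := iter_dom s pL.
have /andP[_ g1] := iter_dom s yL.
rewrite !iterS (@keane_transl _ _ _ _ kT (iter s T p) (iter s T y))//.
- by rewrite e1; ring.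
- by rewrite e1; lra.
move=> e eD; apply/negP => /andP[h1 h2].
have h : p < p + (e - iter s T p) <= x by case/andP: yx; lra.
have hh : p <= p + (e - iter s T p) <= x by case/andP: yx; lra.
have := H _ s h sm; rewrite (IH _ hh (ltnW sm)).
by rewrite (_ : _ + _ = e) ?eD//; ring.
Qed.

(** If an interval never returned to itself, at most one of its points would ever
   reach a given break, so some subinterval would meet no break; its iterates
   would be disjoint intervals of the same length in [0, L). *)
Lemma no_wandering (p q : R) : 0 <= p -> p < q -> q <= L ->
  exists m w, p <= w < q /\ p <= iter m.+1 T w < q.
Proof.
move=> p0 pq qL; apply: contrapT => wand.
have wdr m w : p <= w < q -> ~ (p <= iter m.+1 T w < q).
  by move=> wpq wm; apply: wand; exists m, w.
have inL x : p <= x < q -> 0 <= x < L by lra.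
pose F z := [set e | p < e < q /\ exists m, iter m T e = z].
have Funiq z e e' : F z e -> F z e' -> e = e'.
  move=> [epq [m em]] [epq' [m' em']].
  have eL : 0 <= e < L by apply: inL; lra.
  have eL' : 0 <= e' < L by apply: inL; lra.
  have [mm'|m'm|mm'] := ltngtP m m'.
  - have := iter_cancel eL eL' (ltnW mm') (etrans em (esym em')).
    have [k ->] : exists k, (m' - m = k.+1)%N by apply: subn_succ.
    move=> E; case: (@wdr k e'); [lra|rewrite -E; lra].
  - have := iter_cancel eL' eL (ltnW m'm) (etrans em' (esym em)).
    have [k ->] : exists k, (m - m' = k.+1)%N by apply: subn_succ.
    move=> E; case: (@wdr k e); [lra|rewrite -E; lra].
  - by apply: (@iter_inj m) => //; rewrite em mm' em'.
have [//|q' q'E q'min] := @seq_has_min _ (q :: [seq xget q (F z) | z <- D]).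
have pq' : p < q' <= q.
  move: q'E; rewrite inE => /orP[/eqP->|/mapP[z zD ->]]; first by rewrite pq lexx.
  by case: xgetP => [x _ [+ _]|_]; lra.
have nohit y s : p < y < q' -> iter s T y \notin D.
  move=> ypq; apply/negP => yD.
  have Fy : F (iter s T y) y by split; [lra|exists s].
  have qle : q' <= xget q (F (iter s T y)).
    by apply: q'min; rewrite inE (map_f (fun z => xget q (F z)) yD) orbT.
  move: qle; case: xgetP => [x _ Fx|/(_ y)//]; rewrite (Funiq _ _ _ Fx Fy); lra.
have tr m x : p <= x < q' -> iter m T x = iter m T p + (x - p).
  move=> xpq; apply: (@travel p x m) => //; [lra| |lra].
  by move=> y s yx _; apply: nohit; lra.
have pL : 0 <= p < L by lra.
have [||m [m' [mm' near]]] := @real_pigeonhole _ L (q' - p) (fun m => iter m T p).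
- by move=> m; exact: iter_dom.
- lra.
have [k kE] : exists k, (m' - m = k.+1)%N by apply: subn_succ.
have [le1|lt1] := leP (iter m T p) (iter m' T p).
  pose x := p + (iter m' T p - iter m T p).
  have xpq : p <= x < q' by rewrite /x; move: near; rewrite ler0_norm; lra.
  have E : iter m T x = iter m' T p by rewrite (tr m x xpq) /x; ring.
  have xL : 0 <= x < L by lra.
  have := iter_cancel xL pL (ltnW mm') E; rewrite kE => E'.
  by case: (@wdr k p); [lra|rewrite -E'; lra].
pose x := p + (iter m T p - iter m' T p).
have xpq : p <= x < q' by rewrite /x; move: near; rewrite gtr0_norm; lra.
have E : iter m' T x = iter m T p by rewrite (tr m' x xpq) /x; ring.
have xL : 0 <= x < L by lra.
have := iter_cancel pL xL (ltnW mm') (esym E); rewrite kE => E'.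
by case: (@wdr k x); [lra|rewrite -E'; lra].
Qed.

End Keane.

Lemma least_witness (P : nat -> Prop) : (exists m, P m) ->
  exists2 m, P m & forall s, (s < m)%N -> ~ P s.
Proof.
move=> [m Pm]; have ex : exists m, `[< P m >] by exists m; apply/asboolP.
exists (ex_minn ex); case: ex_minnP => k /asboolP Pk mink //.
by move=> s sk /asboolP/mink; rewrite leqNgt sk.
Qed.

Section KeaneReturn.
Context (R : realType) (L : R) (T : R -> R) (D : seq R) (kT : keane_map L T D).

(** The points of K that reach a break or an end of K no later than their first
   return are at most one for each such target, besides the target itself.  They
   cut K into finitely many intervals with constant return time, which exists by
   [no_wandering]. *)
Lemma bounded_return (c d : R) : 0 <= c -> c < d -> d <= L ->
  exists M, forall x, c <= x < d ->
    exists2 m, (m < M)%N & c <= iter m.+1 T x < d.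
Proof.
move=> c0 cd dL; pose K x := c <= x < d.
have KL x : K x -> 0 <= x < L by rewrite /K; lra.
pose Z := c :: d :: D.
pose F z := [set e | K e /\ exists2 m, iter m.+1 T e = z &
  forall s, (s < m)%N -> ~ K (iter s.+1 T e)].
have Funiq z e e' : F z e -> F z e' -> e = e'.
  move=> [Ke [m em mK]] [Ke' [m' em' mK']].
  have [mm'|m'm|mm'] := ltngtP m m'.
  - have h : (m.+1 <= m'.+1)%N by exact: ltnW.
    have := iter_cancel kT (KL _ Ke) (KL _ Ke') h (etrans em (esym em')).
    have [k kE] := subn_succ mm'.
    rewrite subSS kE => E; case: (mK' k); last by rewrite -E.
    by rewrite -kE; rewrite leq_subr.
  - have h : (m'.+1 <= m.+1)%N by exact: ltnW.
    have := iter_cancel kT (KL _ Ke') (KL _ Ke) h (etrans em' (esym em)).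
    have [k kE] := subn_succ m'm.
    rewrite subSS kE => E; case: (mK k); last by rewrite -E.
    by rewrite -kE; rewrite leq_subr.
  - by apply: (@iter_inj _ _ _ _ kT m.+1); rewrite ?KL// em mm' em'.
(* The targets themselves are cuts at time 0. *)
pose E := Z ++ [seq xget c (F z) | z <- Z].
have ZE z : z \in Z -> z \in E by rewrite mem_cat => ->.
have FE z e : z \in Z -> F z e -> e \in E.
  move=> zZ Fe; rewrite mem_cat; apply/orP; right.
  have -> : e = xget c (F z).
    by case: xgetP => [x _ Fx|/(_ e)//]; exact: Funiq Fe Fx.
  exact: (map_f (fun z => xget c (F z)) zZ).
have together m e x : K e -> K x -> e <= x ->
    (forall e', e' \in E -> ~~ (e < e' <= x)) ->
    (forall s, (s < m)%N -> ~ K (iter s.+1 T e)) ->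
    forall y, e <= y <= x -> iter m.+1 T y = iter m.+1 T e + (y - e) /\
      (K (iter m.+1 T y) <-> K (iter m.+1 T e)).
  move=> Ke Kx ex nE; elim/ltn_ind: m => m IH noK.
  have noKy y s : e <= y <= x -> (s < m)%N -> ~ K (iter s.+1 T y).
    move=> yx sm; have [|_ ->] := IH s sm _ y yx; last exact: noK.
    by move=> s' s's; apply: noK; exact: ltn_trans sm.
  have Ky y : e <= y <= x -> K y by move: Ke Kx; rewrite /K; lra.
  have notZ y s : e < y <= x -> (s <= m.+1)%N -> iter s T y \notin Z.
    move=> yx sm; apply/negP => yZ.
    have yE : y \in E.
      case: s sm yZ => [|s] sm yZ; first exact: ZE.
      apply: FE yZ _; split; first by apply: Ky; lra.
      exists s => // s' s's; apply: noKy; first lra.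
      exact: leq_trans s's sm.
    by have := nE y yE; rewrite yx.
  have tr y : e <= y <= x -> iter m.+1 T y = iter m.+1 T e + (y - e).
    move=> yx; apply: (@travel _ _ _ _ kT e x m.+1) => //.
    - by have := KL _ Ke; lra.
    - by have := KL _ Kx; lra.
    move=> y' s y'x sm; have := notZ y' s y'x (ltnW sm).
    by rewrite !inE !negb_or => /and3P[].
  move=> y yx; split; first exact: tr.
  have noz z : z \in Z -> ~~ (iter m.+1 T e < z <= iter m.+1 T y).
    move=> zZ; apply/negP; rewrite (tr y yx) => zz.
    pose y' := e + (z - iter m.+1 T e).
    have y'x : e < y' <= x by rewrite /y'; lra.
    have := notZ y' m.+1 y'x (leqnn _); rewrite tr; last by lra.
    by rewrite /y' (_ : _ + _ = z) ?zZ//; ring.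
  have cZ : c \in Z by rewrite inE eqxx.
  have dZ : d \in Z by rewrite !inE eqxx orbT.
  move: (noz c cZ) (noz d dZ); rewrite /K (tr y yx) => /negP h1 /negP h2.
  split=> h; apply: contrapT => h'.
    have [h3|h3] := ltP (iter m.+1 T e) c; [apply: h1|apply: h']; lra.
  by have [h3|h3] := ltP (iter m.+1 T e + (y - e)) d; [apply: h'|apply: h2]; lra.
have ret e : e \in E -> exists m, K e ->
    K (iter m.+1 T e) /\ forall s, (s < m)%N -> ~ K (iter s.+1 T e).
  move=> eE; have [Ke|] := pselect (K e); last by exists 0%N.
  have [//|q qE qmin] := @seq_has_min _ (d :: [seq e' <- E | e < e']).
  have eq : e < q <= d.
    have := qmin d; rewrite inE eqxx => /(_ isT) ->; rewrite andbT.
    move: qE; rewrite inE => /orP[/eqP->|]; last by rewrite mem_filter => /andP[].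
    by have /andP[] := Ke.
  have qnE e' : e' \in E -> e < e' -> q <= e'.
    by move=> e'E ee'; apply: qmin; rewrite inE mem_filter ee' e'E orbT.
  have [|m Km mK] := @least_witness (fun m => K (iter m.+1 T e)); last by exists m.
    apply: contrapT => no.
    have noK s : ~ K (iter s.+1 T e) by move=> h; apply: no; exists s.
    have [||| m [w [weq wm]]] := @no_wandering _ _ _ _ kT e q; move: (Ke); rewrite /K; try lra.
    move=> Ke'; have Kw : K w by rewrite /K; lra.
    have [||||_ h] := together m e w Ke Kw _ _ _ w.
    - by lra.
    - move=> e' e'E; apply/negP => h; have := qnE e' e'E; lra.
    - by move=> s _; exact: noK.
    - by lra.
    by apply: (noK m); apply/h; rewrite /K; lra.
have [M HM] := seq_bounded_witness ret.
exists M => x Kx.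
have [|e] := @seq_has_min _ [seq x - e | e <- [seq e <- E | e <= x]].
  have : c \in [seq e <- E | e <= x] by rewrite mem_filter ZE ?inE ?eqxx// andbT; case/andP: Kx.
  by case: [seq e <- E | e <= x].
move=> /mapP[e']; rewrite mem_filter => /andP[e'x e'E] -> emin.
have max e2 : e2 \in E -> e2 <= x -> e2 <= e'.
  move=> e2E e2x; have : x - e' <= x - e2.
    by apply: emin; apply: map_f; rewrite mem_filter e2x.
  by lra.
have Ke : K e'.
  have := max c; rewrite ZE ?inE ?eqxx// => /(_ isT).
  by move: Kx; rewrite /K; lra.
have [m mM [//|Km nK]] := HM _ e'E; exists m => //.
have [||_ h] := together m e' x Ke Kx e'x _ nK x.
- move=> e2 e2E; apply/negP => h; have := max e2 e2E; lra.
- by lra.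
exact/h.
Qed.

End KeaneReturn.

(** Connectedness of [0, L), for properties that are only known to be locally
   constant on each side separately. *)
Lemma real_induction_iff (R : realType) (L : R) (P : R -> Prop) :
  (forall x, 0 <= x < L -> small (fun t => P (x + t) <-> P x)) ->
  (forall x, 0 < x < L -> small (fun t => P (x - t) <-> P x)) ->
  forall x, 0 <= x < L -> (P x <-> P 0).
Proof.
move=> Pr Pl x1 /andP[x10 x1L].
pose S := [set x | 0 <= x <= x1 /\ forall y, 0 <= y <= x -> (P y <-> P 0)].
have S0 : S 0.
  by split=> [|y y0]; [rewrite lexx|have -> : y = 0 by lra].
have supS : has_sup S by split; [exists 0|exists x1 => y [/andP[]]].
have s0 : 0 <= sup S by exact: ub_le_sup supS.2 _ S0.
have sx1 : sup S <= x1 by apply: ge_sup; [exists 0|move=> y [/andP[]]].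
have below y : 0 <= y -> y < sup S -> (P y <-> P 0).
  move=> y0 ys; have d0 : 0 < sup S - y by lra.
  have [z [_ Pz] zs] := sup_adherent d0 supS.
  by apply: Pz; rewrite y0/=; lra.
have Ps : P (sup S) <-> P 0.
  have [->|sn0] := eqVneq (sup S) 0; first by [].
  have spos : 0 < sup S by rewrite lt_neqAle eq_sym sn0.
  have [|e e0 eP] := Pl (sup S); first by lra.
  pose t := Num.min (e / 2) (sup S).
  have t0 : 0 < t by rewrite lt_min spos divr_gt0.
  have te : t <= e / 2 by rewrite /t ge_min lexx.
  have ts : t <= sup S by rewrite /t ge_min lexx orbT.
  have [h1 h2] : P (sup S - t) <-> P (sup S) by apply: eP; lra.
  have [h3 h4] : P (sup S - t) <-> P 0 by apply: below; lra.
  by split=> [/h2/h3|/h4/h1].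
have [<-//|sneq] := eqVneq (sup S) x1.
have slt : sup S < x1 by rewrite lt_neqAle sneq.
have [|e e0 eP] := Pr (sup S); first by lra.
pose t := Num.min (e / 2) (x1 - sup S).
have t0 : 0 < t by rewrite lt_min divr_gt0 ?subr_gt0.
have te : t <= e / 2 by rewrite /t ge_min lexx.
have ts : t <= x1 - sup S by rewrite /t ge_min lexx orbT.
have : S (sup S + t).
  split=> [|y /andP[y0 yst]]; first lra.
  have [/below->//|sy] := ltP y (sup S).
  have -> : y = sup S + (y - sup S) by ring.
  rewrite (_ : P (sup S + (y - sup S)) <-> P 0)//.
  apply: iff_trans Ps; apply: eP; lra.
by move=> /(ub_le_sup supS.2); lra.
Qed.

Section KeaneMinimal.
Context (R : realType) (L : R) (T : R -> R) (D : seq R) (kT : keane_map L T D).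

Definition preimage_pt y := xget 0 [set x | 0 <= x < L /\ T x = y].
Local Notation Ti := preimage_pt.

Lemma preimage_ptP y : 0 <= y < L -> 0 <= Ti y < L /\ T (Ti y) = y.
Proof.
move=> yL; rewrite /Ti; case: xgetP => [x _ []//|no].
by have [x xL xy] := keane_surj kT yL; case: (no x).
Qed.

Lemma preimage_ptK x : 0 <= x < L -> Ti (T x) = x.
Proof.
move=> xL; have [h1 h2] := preimage_ptP (keane_dom kT xL).
exact: (keane_inj kT h1 xL h2).
Qed.

Lemma preimage_pt_eq x y : 0 <= x < L -> T x = y -> Ti y = x.
Proof. by move=> xL <-; exact: preimage_ptK. Qed.

Lemma iter_preimage_dom m y : 0 <= y < L -> 0 <= iter m Ti y < L.
Proof. by move=> yL; elim: m => //= m /preimage_ptP[]. Qed.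

Lemma iter_preimageK m y : 0 <= y < L -> iter m T (iter m Ti y) = y.
Proof.
move=> yL; elim: m => //= m IH; rewrite -iterS iterSr.
by have [_ ->] := preimage_ptP (iter_preimage_dom m yL).
Qed.

Lemma iter_preimage_iter m k x : 0 <= x < L -> (k <= m)%N ->
  iter k Ti (iter m T x) = iter (m - k) T x.
Proof.
move=> xL; elim: k => [|k IH] km; first by rewrite subn0.
rewrite iterS IH; last exact: ltnW.
by rewrite -(subnSK km) iterS preimage_ptK//; exact: (iter_dom kT).
Qed.

Lemma small_right x : 0 <= x < L -> small (fun t => x + t < L /\ T (x + t) = T x + t).
Proof.
move=> /andP[x0 xL].
have h1 : small (fun t => t < L - x) by apply: small_lt; lra.
have h2 : small (fun t => forall e, e \in D -> ~~ (x < e <= x + t)).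
  apply: small_all => e _; have [xe|ex] := ltP x e.
    by apply: smallS (@small_lt _ (e - x) _) => [t _ /= h|]; [apply/negP; lra|lra].
  by exists 1 => // t _.
apply: smallS (smallI h1 h2) => t t0 [h3 h4]; split; first lra.
rewrite (@keane_transl _ _ _ _ kT x (x + t))//; [ring|lra|lra].
Qed.

Lemma small_left x : 0 < x < L -> x \notin D ->
  small (fun t => 0 <= x - t /\ T (x - t) = T x - t).
Proof.
move=> /andP[x0 xL] xD.
have h1 : small (fun t => t < x) by apply: small_lt.
have h2 : small (fun t => forall e, e \in D -> ~~ (x - t < e <= x)).
  apply: small_all => e eD; have [xe|ex] := leP x e.
    exists 1 => // t _; apply/negP => h; have : e = x by lra.
    by move=> ex; rewrite -ex eD in xD.
  by apply: smallS (@small_lt _ (x - e) _) => [t _ /= h|]; [apply/negP; lra|lra].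
apply: smallS (smallI h1 h2) => t t0 [h3 h4]; split; first lra.
by rewrite (@keane_transl _ _ _ _ kT (x - t) x)//; [ring|lra|lra].
Qed.

(** Let X be the union of the iterates of K up to the return bound M.  It is
   forward invariant, and backward invariant because the difference would contain
   a wandering interval.  A boundary point of X stays in the finite boundary,
   forward until it meets a break and backward until it is the image of one; by
   aperiodicity both happen, which connects two breaks.  So X has no boundary. *)
Theorem keane_minimal (c d : R) : 0 <= c -> c < d -> d <= L ->
  exists M, forall x, 0 <= x < L ->
    (exists2 m, (m <= M)%N & c <= iter m T x < d) /\
    (exists m y, [/\ (m <= M)%N, c <= y < d & iter m T y = x]).
Proof.
move=> c0 cd dL; pose K x := c <= x < d.
have KL x : K x -> 0 <= x < L by rewrite /K; lra.
have [M retM] := bounded_return kT c0 cd dL.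
pose X x := exists2 m, (m <= M)%N & K (iter m Ti x).
have Xfwd x : 0 <= x < L -> X x -> X (T x).
  move=> xL [m mM Km]; have [mM'|mM'] := ltnP m M.
    by exists m.+1 => //; rewrite iterSr preimage_ptK.
  have {mM mM'} mE : m = M by apply/eqP; rewrite eqn_leq mM mM'.
  subst m; have [s sM Ks] := retM _ Km.
  exists (M - s)%N; first exact: leq_subr.
  have -> : T x = iter M.+1 T (iter M Ti x) by rewrite iterS iter_preimageK.
  rewrite iter_preimage_iter//; [|exact: iter_preimage_dom|by lia].
  by rewrite (_ : (M.+1 - (M - s) = s.+1)%N)//; lia.
have Xright x : 0 <= x < L -> small (fun t => x + t < L /\ (X (x + t) <-> X x)).
  move=> xL.
  have step m : small (fun t => x + t < L /\ iter m Ti (x + t) = iter m Ti x + t).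
    elim: m => [|m IH]; first by apply: smallS (small_lt (c := L - x) _) => [t _ /=|]; lra.
    have h := small_right (iter_preimage_dom m.+1 xL).
    apply: smallS (smallI IH h) => t t0 [[xtL e1] [h1 h2]]; split=> //.
    rewrite iterS e1; apply: preimage_pt_eq.
      by have := iter_preimage_dom m.+1 xL; lra.
    by rewrite h2 iterS (preimage_ptP (iter_preimage_dom m xL)).2.
  have stepK m : small (fun t => x + t < L /\ (K (iter m Ti (x + t)) <-> K (iter m Ti x))).
    set u := iter m Ti x.
    have hK : small (fun t => K (u + t) <-> K u).
      have [uc|cu] := ltP u c.
        by apply: smallS (small_lt (c := c - u) _) => [t t0 tc|]; rewrite /K; lra.
      have [ud|du] := ltP u d.
        by apply: smallS (small_lt (c := d - u) _) => [t t0 tc|]; rewrite /K; lra.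
      by exists 1 => // t /andP[t0 _]; rewrite /K; split; lra.
    by apply: smallS (smallI hK (step m)) => t _ [h [h1 ->]].
  have all := small_all (s := iota 0 M.+1) (fun m _ => stepK m).
  have h0 : small (fun t => t < L - x) by apply: small_lt; lra.
  apply: smallS (smallI h0 all) => t t0 [xtL H]; split; first lra.
  by split=> -[m mM Km]; exists m => //; have [|_ h] := H m; rewrite ?mem_iota//; apply/h.
have Xbwd x : 0 <= x < L -> X (T x) -> X x.
  move=> xL XTx; apply: contrapT => nX.
  have [e1 e10 H1] := smallI (Xright x xL) (small_right xL).
  have [e2 e20 H2] := Xright (T x) (keane_dom kT xL).
  pose e := Num.min (Num.min e1 e2) (L - x).
  have e0 : 0 < e by rewrite !lt_min e10 e20 /=; lra.
  have ee1 : e <= e1 by rewrite /e !ge_min lexx.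
  have ee2 : e <= e2 by rewrite /e !ge_min lexx orbT.
  have eL : e <= L - x by rewrite /e !ge_min lexx orbT.
  have [|||m [w [wx wm]]] := @no_wandering _ _ _ _ kT x (x + e); try lra.
  have nXw w' : x <= w' < x + e -> ~ X w'.
    move=> wx'; have [|[_ h] _] := H1 (w' - x); first lra.
    by rewrite subrKC in h => /h.
  apply: nXw wm _.
  have XTw : X (T w).
    have [|_ [_ h]] := H1 (w - x); first lra.
    rewrite subrKC in h; rewrite h; have [|_ h'] := H2 (w - x); first lra.
    exact/h'.
  by elim: m => //= m IH; apply: Xfwd => //; apply: (iter_dom kT m.+1); lra.
pose bad := [seq iter m T z | m <- index_iota 0 M.+2, z <- 0 :: c :: d :: D].
have Xleft x : 0 < x < L -> x \notin bad -> small (fun t => 0 <= x - t /\ (X (x - t) <-> X x)).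
  move=> xL nbad; have xL' : 0 <= x < L by lra.
  have nb m : (m <= M.+1)%N -> iter m Ti x \notin 0 :: c :: d :: D.
    move=> mM; apply/negP => h; move/negP: nbad; apply.
    apply/allpairsP; exists (m, iter m Ti x); split=> //.
      by rewrite mem_index_iota.
    by rewrite /= iter_preimageK.
  have step m : (m <= M)%N -> small (fun t => 0 <= x - t /\ iter m Ti (x - t) = iter m Ti x - t).
    elim: m => [|m IH] mM; first by apply: smallS (small_lt (c := x) _) => [t _ /=|]; lra.
    have nbm := nb m.+1 (leqW mM); rewrite !inE !negb_or in nbm.
    case/and4P: nbm => n0 _ _ nD.
    have dm := iter_preimage_dom m.+1 xL'.
    have dm' : 0 < iter m.+1 Ti x < L by rewrite lt_neqAle eq_sym n0.
    apply: smallS (smallI (IH (ltnW mM)) (small_left dm' nD)) => t t0 [[xtL e1] [h1 h2]].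
    split=> //; rewrite iterS e1; apply: preimage_pt_eq; first lra.
    by rewrite h2 iterS (preimage_ptP (iter_preimage_dom m xL')).2.
  have stepK m : (m <= M)%N ->
      small (fun t => 0 <= x - t /\ (K (iter m Ti (x - t)) <-> K (iter m Ti x))).
    move=> mM; have := nb m (leqW mM); rewrite !inE !negb_or => /and4P[_ nc nd _].
    have hK : small (fun t => K (iter m Ti x - t) <-> K (iter m Ti x)).
      have [uc|cu] := leP (iter m Ti x) c.
        have : iter m Ti x < c by rewrite lt_neqAle nc.
        by move=> h; exists 1 => // t /andP[t0 _]; rewrite /K; split; lra.
      have [ud|du] := leP (iter m Ti x) d.
        have : iter m Ti x < d by rewrite lt_neqAle nd.
        move=> h.
        by apply: smallS (small_lt (c := iter m Ti x - c) _) => [t t0 tc|]; rewrite /K; lra.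
      by apply: smallS (small_lt (c := iter m Ti x - d) _) => [t t0 tc|]; rewrite /K; lra.
    by apply: smallS (smallI hK (step m mM)) => t _ [h [h1 ->]].
  have all : small (fun t => forall m, m \in iota 0 M.+1 ->
      0 <= x - t /\ (K (iter m Ti (x - t)) <-> K (iter m Ti x))).
    by apply: small_all => m; rewrite mem_iota => mM; apply: stepK.
  have h0 : small (fun t => t < x) by apply: small_lt; lra.
  apply: smallS (smallI h0 all) => t t0 [xtL H]; split; first lra.
  by split=> -[m mM Km]; exists m => //; have [|_ h] := H m; rewrite ?mem_iota//; apply/h.
(* The boundary points of X are interior, and their whole orbit stays in the
   boundary until it meets a break point. *)
pose Bd x := 0 < x < L /\ ~ small (fun t => X (x - t) <-> X x).
have Bd_bad x : Bd x -> x \in bad.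
  move=> [xL nX]; apply: contrapT => /negP nb; apply: nX.
  by apply: smallS (Xleft x xL nb) => t _ [].
have XT x : 0 <= x < L -> (X (T x) <-> X x).
  by move=> xL; split; [exact: Xbwd|exact: Xfwd].
have [z0 z0D Tz0] := keane_zero kT.
have Bd_fwd x : Bd x -> x \notin D -> Bd (T x).
  move=> [xL nX] xD; have xL' : 0 <= x < L by lra.
  have /andP[Tx0 TxL] := keane_dom kT xL'.
  split.
    rewrite TxL andbT lt_neqAle Tx0 andbT; apply/negP => /eqP T0.
    rewrite T0 in Tz0; move/negP: xD; apply.
    by rewrite -(keane_inj kT (break_dom kT z0D) xL' Tz0).
  move=> h; apply: nX; apply: smallS (smallI h (small_left xL xD)) => t t0 [h1 [h2 h3]].
  have h4 : X (T (x - t)) <-> X (x - t) by apply: XT; lra.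
  by rewrite h3 in h4; apply: iff_trans (iff_sym h4) _; apply: iff_trans h1 (XT _ xL').
have Bd_bwd x : Bd x -> (exists z m, z \in D /\ x = iter m.+1 T z) \/ Bd (Ti x).
  move=> [xL nX]; have xL' : 0 <= x < L by lra.
  have [dL' TdE] := preimage_ptP xL'.
  have [dD|dD] := boolP (Ti x \in D); first by left; exists (Ti x), 0%N.
  have [d0|dn0] := eqVneq (Ti x) 0.
    by left; exists z0, 1%N; split=> //; rewrite /= Tz0 -d0.
  have dpos : 0 < Ti x < L by rewrite lt_neqAle eq_sym dn0.
  right; split=> // h; apply: nX.
  apply: smallS (smallI h (small_left dpos dD)) => t t0 [h1 [h2 h3]].
  have h4 : X (T (Ti x - t)) <-> X (Ti x - t) by apply: XT; lra.
  have h5 := XT _ dL'; rewrite TdE in h5.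
  by rewrite h3 TdE in h4; exact: iff_trans h4 (iff_trans h1 (iff_sym h5)).
have noBd x : ~ Bd x.
  move=> Bx; have xL : 0 <= x < L by case: Bx => ? _; lra.
  have [m mD] : exists m, iter m T x \in D.
    apply: contrapT => no.
    have all m : iter m T x \in bad.
      apply: Bd_bad; elim: m => //= m IH; apply: Bd_fwd IH _.
      by apply/negP => h; apply: no; exists m.
    have [m [m' [mm' e]]] := seq_pigeonhole all.
    have [k kE] := subn_succ mm'.
    have := iter_cancel kT xL xL (ltnW mm') e; rewrite kE => /esym.
    exact: (keane_aperiodic kT).
  have [z [m' [zD xz]]] : exists z m, z \in D /\ x = iter m.+1 T z.
    apply: contrapT => no.
    have BdT k : Bd (iter k Ti x).
      elim: k => //= k IH; have [[z [s [zD e]]]|//] := Bd_bwd _ IH.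
      case: no; exists z, (k + s)%N; split=> //.
      by rewrite -addnS iterD -e iter_preimageK.
    have all k : iter k Ti x \in bad by exact: Bd_bad.
    have [k [k' [kk' e]]] := seq_pigeonhole all.
    have [s sE] := subn_succ kk'.
    apply: (keane_aperiodic kT (s := s) xL).
    rewrite -{1}(iter_preimageK k xL) e -sE -iterD subnK; last exact: ltnW.
    exact: iter_preimageK.
  rewrite xz -iterD addnS in mD.
  exact: (keane_no_connection kT (s := (m + m')%N) zD mD).
have Xall x : 0 <= x < L -> X x.
  have X0 := @real_induction_iff _ L X.
  have {}X0 : forall x, 0 <= x < L -> (X x <-> X 0).
    apply: X0 => y yL; first by apply: smallS (Xright y yL) => t _ [].
    by apply: contrapT => h; exact: (noBd y).
  have Xc : X c by exists 0%N => //=; rewrite /K lexx cd.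
  have cL : 0 <= c < L by lra.
  by move=> xL; apply/(X0 x xL)/(X0 c cL).
exists M => x xL; split; last first.
  by have [m mM Km] := Xall x xL; exists m, (iter m Ti x); rewrite iter_preimageK.
have hit k y : K y -> exists2 s, (s <= M)%N & K (iter s T (iter k T y)).
  move=> Ky; elim: k => [|k [s sM Ks]]; first by exists 0%N.
  case: s sM Ks => [|s] sM Ks.
    by have [s sM' Ks'] := retM _ Ks; exists s => //; [exact: ltnW|rewrite iterS -iterSr].
  by exists s; [exact: ltnW|rewrite iterS -iterSr].
have [m mM Km] := Xall x xL; have := hit m _ Km; rewrite iter_preimageK//.
Qed.

End KeaneMinimal.

(** * Pieces, and the exchange as a map of its interval *)

Section Endpoints.
Context (R : realType) (n : nat) (a : R) (lam : 'rV[R]_n).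

Lemma pieceE (j : 'I_n) x :
  piece a lam j x = (endpoint a lam j <= x < endpoint a lam j.+1) :> Prop.
Proof. by rewrite /piece /= in_itv. Qed.

Lemma hullE x : hull a lam x = (a <= x < endpoint a lam n) :> Prop.
Proof. by rewrite /hull /= in_itv. Qed.

Lemma endpoint0 : endpoint a lam 0 = a.
Proof. by rewrite /endpoint big_pred0 ?addr0. Qed.

Lemma endpointS (j : 'I_n) : endpoint a lam j.+1 = endpoint a lam j + lam 0 j.
Proof.
rewrite /endpoint -addrA; congr (_ + _).
rewrite (bigD1 j)//= addrC; congr (_ + _); apply: eq_bigl => i.
by rewrite ltnS [in RHS]ltn_neqAle andbC.
Qed.

Hypothesis lam0 : positive_vector lam.

Lemma endpoint_le j k : (j <= k)%N -> endpoint a lam j <= endpoint a lam k.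
Proof.
move=> jk; rewrite lerD2l big_mkcond [leRHS]big_mkcond; apply: ler_sum => i _.
case: ifP => [ij|_]; first by rewrite (leq_trans ij).
by case: ifP => // _; exact: ltW.
Qed.

Lemma endpoint_lt (j : 'I_n) k : (j < k)%N -> endpoint a lam j < endpoint a lam k.
Proof.
by move=> /endpoint_le; apply: lt_le_trans; rewrite endpointS ltrDl.
Qed.

Lemma piece_cover x : hull a lam x -> exists j, piece a lam j x.
Proof.
rewrite hullE => /andP[ax xn].
have [|m xm mmin] := @least_witness (fun m => x < endpoint a lam m); first by exists n.
case: m xm mmin => [|m] xm mmin.
  by move: xm; rewrite endpoint0 ltNge ax.
have mn : (m < n)%N.
  by rewrite ltnNge; apply/negP => nm; exact: (mmin n).
exists (Ordinal mn); rewrite pieceE xm andbT leNgt; apply/negP.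
exact: mmin.
Qed.

Lemma piece_hull (j : 'I_n) x : piece a lam j x -> hull a lam x.
Proof.
rewrite pieceE hullE => /andP[jx xj].
rewrite (le_trans _ jx) -?[X in X <= _]endpoint0 ?endpoint_le//=.
exact: lt_le_trans xj (endpoint_le _).
Qed.

Lemma piece_uniq (j k : 'I_n) x : piece a lam j x -> piece a lam k x -> j = k.
Proof.
rewrite !pieceE => /andP[jx xj] /andP[kx xk]; apply: val_inj => /=.
apply/eqP; rewrite eqn_leq; apply/andP; split; rewrite leqNgt; apply/negP.
  by move=> /endpoint_le; have := lt_le_trans xk; lra.
by move=> /endpoint_le; lra.
Qed.

Lemma piece_left (j : 'I_n) : piece a lam j (endpoint a lam j).
Proof. by rewrite pieceE lexx endpoint_lt. Qed.

End Endpoints.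

Section Exchange.
Context (R : realType) (n : nat) (pi : 'S_n) (lam : 'rV[R]_n).
Hypothesis lam0 : positive_vector lam.

Local Notation T := (iet pi lam).
Local Notation be := (endpoint 0 lam).
Local Notation L := (be n).

(** The images of the pieces partition the same interval, with the lengths
   listed in the order of the images. *)
Definition image_lengths : 'rV[R]_n := \row_i lam 0 ((pi^-1)%g i).
Local Notation ga := (endpoint 0 image_lengths).

Lemma image_lengths_gt0 : positive_vector image_lengths.
Proof. by move=> i; rewrite mxE. Qed.

Lemma endpoint_image k : ga k = \sum_(i < n | (pi i < k)%N) lam 0 i.
Proof.
rewrite /endpoint add0r (reindex_inj (@perm_inj _ pi)) /=.
by apply: eq_bigr => i _; rewrite mxE permK.
Qed.

Lemma endpoint_image_total : ga n = L.
Proof.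
rewrite endpoint_image /endpoint add0r.
by apply: eq_bigl => i; rewrite !ltn_ord.
Qed.

Lemma iet_on_piece (j : 'I_n) x : piece 0 lam j x -> T x = ga (pi j) + (x - be j).
Proof.
move=> jx; rewrite /iet; case: pickP => [k kx|/(_ j)]; last by rewrite jx.
rewrite (piece_uniq lam0 (kx : piece 0 lam k x) jx) /iet_shift endpoint_image /endpoint.
ring.
Qed.

Lemma iet_piece (j : 'I_n) x :
  piece 0 lam j x -> piece 0 image_lengths (pi j) (T x).
Proof.
move=> jx; rewrite pieceE endpointS (iet_on_piece jx).
by move: jx; rewrite pieceE endpointS mxE permK; lra.
Qed.

Lemma iet_lt (j k : 'I_n) x y : piece 0 lam j x -> piece 0 lam k y ->
  (T x < T y) = if j == k then x < y else (pi j < pi k)%N.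
Proof.
move=> jx ky; case: eqVneq => [jk|jk].
  by subst k; rewrite (iet_on_piece jx) (iet_on_piece ky) ltrD2l ltrD2r.
have := iet_piece jx; have := iet_piece ky; rewrite !pieceE.
have [jk'|kj'|/val_inj/perm_inj] := ltngtP (pi j) (pi k); last by move/eqP: jk.
  by have := endpoint_le 0 image_lengths_gt0 jk'; lra.
move=> h1 h2; have := endpoint_le 0 image_lengths_gt0 kj'.
by move=> h; apply/negbTE; rewrite -leNgt; lra.
Qed.

Definition breaks : seq R := [seq be (val j) | j : 'I_n <- enum 'I_n & (0 < j)%N].

Lemma breaksP e : reflect (exists2 j : 'I_n, (0 < j)%N & e = be j) (e \in breaks).
Proof.
apply: (iffP mapP) => [[j]|[j j0 ->]].
  by rewrite mem_filter => /andP[j0 _] ->; exists j.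
by exists j => //; rewrite mem_filter j0 mem_enum.
Qed.

Lemma hull0E x : hull 0 lam x = (0 <= x < L) :> Prop.
Proof. by rewrite hullE. Qed.

Lemma iet_dom x : 0 <= x < L -> 0 <= T x < L.
Proof.
rewrite -hull0E => /(piece_cover)[j /iet_piece/(piece_hull image_lengths_gt0)].
by rewrite hullE endpoint_image_total.
Qed.

Lemma iet_inj x y : 0 <= x < L -> 0 <= y < L -> T x = T y -> x = y.
Proof.
rewrite -!hull0E => /piece_cover[j jx] /piece_cover[k ky] e.
have := iet_piece jx; rewrite e => /(piece_uniq image_lengths_gt0 (iet_piece ky)).
move=> /perm_inj kj; subst k.
by move: e; rewrite (iet_on_piece jx) (iet_on_piece ky); lra.
Qed.

Lemma iet_surj y : 0 <= y < L -> exists2 x, 0 <= x < L & T x = y.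
Proof.
move=> yL; have /piece_cover[i] : hull 0 image_lengths y by rewrite hullE endpoint_image_total.
rewrite -(permKV pi i); set j := (pi^-1)%g i.
rewrite pieceE endpointS mxE permK => h.
have jx : piece 0 lam j (y - ga (pi j) + be j) by rewrite pieceE endpointS; lra.
exists (y - ga (pi j) + be j); last by rewrite (iet_on_piece jx); ring.
by rewrite -hull0E; exact: piece_hull jx.
Qed.

Lemma iet_transl x y : 0 <= x -> x <= y -> y < L ->
  (forall e, e \in breaks -> ~~ (x < e <= y)) -> T y = T x + (y - x).
Proof.
move=> x0 xy yL nob; have : hull 0 lam x by rewrite hull0E; lra.
move=> /piece_cover[j jx].
suff jy : piece 0 lam j y by rewrite (iet_on_piece jx) (iet_on_piece jy); ring.
move: jx; rewrite !pieceE => /andP[jx xj].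
rewrite (le_trans jx)//= ltNge; apply/negP => jy.
have [jn|nj] := ltnP j.+1 n.
  have /nob : be j.+1 \in breaks by apply/breaksP; exists (Ordinal jn).
  by rewrite xj jy.
by have := endpoint_le 0 lam0 nj; lra.
Qed.

(** A connection between two breaks would identify their orbits, and one from a
   break to itself would make its orbit finite. *)
Lemma iet_no_connection (no : forall i j : 'I_n, (0 < i)%N -> (0 < j)%N -> i <> j ->
    Defs.orbit (hull 0 lam) T (be i) <> Defs.orbit (hull 0 lam) T (be j))
  (inf : forall j : 'I_n, (0 < j)%N -> infinite_set (Defs.orbit (hull 0 lam) T (be j)))
  (i j : 'I_n) s : (0 < i)%N -> (0 < j)%N -> iter s.+1 T (be i) <> be j.
Proof.
have itdom m x : 0 <= x < L -> 0 <= iter m T x < L.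
  by move=> xL; elim: m => //= m /iet_dom.
have itinj m x y : 0 <= x < L -> 0 <= y < L -> iter m T x = iter m T y -> x = y.
  move=> xL yL; elim: m => //= m IH /iet_inj e; apply: IH; apply: e; exact: itdom.
have bedom (k : 'I_n) : 0 <= be k < L.
  by rewrite -hull0E; apply: (piece_hull lam0); exact: piece_left.
move=> i0 j0 e.
have sub x y : 0 <= x < L -> 0 <= y < L -> forall m, iter m T x = y ->
    Defs.orbit (hull 0 lam) T x = Defs.orbit (hull 0 lam) T y.
  move=> xL yL m xy; rewrite /Defs.orbit; apply/seteqP; split=> z [].
    rewrite hull0E => zL [k [zk|zk]]; split; rewrite ?hull0E//.
      have [mk|km] := leqP m k.
        by exists (k - m)%N; left; rewrite -xy -iterD subnK.
      exists (m - k)%N; right.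
      by rewrite zk -iterD subnK ?xy// ltnW.
    by exists (k + m)%N; right; rewrite addnC iterD zk.
  rewrite hull0E => zL [k [zk|zk]]; split; rewrite ?hull0E//.
    by exists (k + m)%N; left; rewrite iterD xy.
  have [km|mk] := leqP k m.
    exists (m - k)%N; left; apply: (itinj k) => //; first exact: itdom.
    by rewrite -iterD subnKC// xy.
  exists (k - m)%N; right; apply: (itinj m) => //; first exact: itdom.
  by rewrite -iterD subnKC ?xy// ltnW.
have ij : i = j.
  apply: contrapT => nij; apply: (no i j i0 j0 nij); exact: sub e.
subst j; apply: (inf i i0).
have per k : iter (k * s.+1) T (be i) = be i.
  by elim: k => // k IH; rewrite mulSn iterD IH.
have fwd k : iter k T (be i) = iter (k %% s.+1) T (be i).
  by rewrite {1}(divn_eq k s.+1) addnC iterD per.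
apply: (@sub_finite_set _ _ [set` [seq iter k T (be i) | k <- iota 0 s.+1]]); last exact: finite_seq.
have memb k : iter k T (be i) \in [seq iter k T (be i) | k <- iota 0 s.+1].
  by rewrite fwd; apply/mapP; exists (k %% s.+1)%N => //; rewrite mem_iota ltn_mod.
move=> z []; rewrite hull0E => zL [k [->|zk]]; first exact: memb.
suff -> : z = iter (k * s) T (be i) by exact: memb.
apply: (itinj k) => //; first exact: itdom.
by rewrite -iterD -mulnS per zk.
Qed.

Hypothesis n2 : (2 <= n)%N.
Hypothesis irr : irreducible_perm pi.

Lemma irreducible_preimage0 (j : 'I_n) : pi j = 0%N :> nat -> (0 < j)%N.
Proof.
move=> pj; rewrite lt0n; apply/negP => /eqP j0.
have : (1 <= 1 <= n)%N by rewrite /= ltnW.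
move=> /irr[h _]; have n1 : 1%N <> n by move=> n1; move: n2; rewrite -n1.
apply: n1; apply: h; apply/seteqP; split=> i /=.
  move=> [k kk <-]; have -> : k = j by apply: val_inj => /=; lia.
  by rewrite pj.
by move=> i1; exists j => /=; [rewrite j0|apply: val_inj => /=; lia].
Qed.

Lemma irreducible_preimage_last (j : 'I_n) : pi j = n.-1 :> nat -> (j.+1 < n)%N.
Proof.
move=> pj; rewrite ltn_neqAle ltn_ord andbT; apply/negP => /eqP jn.
have : (1 <= n.-1 <= n)%N by apply/andP; split; lia.
move=> /irr[+ _]; suff h : pi @` [set i : 'I_n | (i < n.-1)%N] = [set i : 'I_n | (i < n.-1)%N].
  by move=> /(_ h); lia.
have lastE (i : 'I_n) : (i < n.-1)%N = (i != j).
  by rewrite -(inj_eq val_inj) /=; have := ltn_ord i; lia.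
have lastE' (i : 'I_n) : (i < n.-1)%N = (i != pi j).
  by rewrite -(inj_eq val_inj) /= pj; have := ltn_ord i; lia.
apply/seteqP; split=> i /=.
  by move=> [k + <-]; rewrite lastE lastE' (inj_eq perm_inj).
by rewrite lastE' => ij; exists ((pi^-1)%g i); rewrite /= ?permKV// lastE -(inj_eq (@perm_inj _ pi)) permKV.
Qed.

Lemma idoc_keane : idoc pi lam -> keane_map L T breaks.
Proof.
move=> [inf no]; split.
- exact: iet_dom.
- exact: iet_inj.
- exact: iet_surj.
- move=> e /breaksP[j j0 ->].
  rewrite -[X in X < _](@endpoint0 R n 0 lam) endpoint_lt//.
  by rewrite (@endpoint_lt _ _ 0 lam lam0 (Ordinal (ltn_trans j0 (ltn_ord j)))).
- exact: iet_transl.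
- have n0 : (0 < n)%N by exact: ltnW.
  pose j0 := (pi^-1)%g (Ordinal n0).
  have pj0 : pi j0 = 0%N :> nat by rewrite permKV.
  exists (be j0).
    by apply/breaksP; exists j0 => //; exact: irreducible_preimage0.
  by rewrite (iet_on_piece (piece_left 0 lam0 j0)) subrr addr0 pj0 endpoint0.
- move=> e e' s /breaksP[i i0 ->] /breaksP[j j0 ->].
  exact: iet_no_connection.
Qed.

End Exchange.

(** * Towers over the intervals of an induction sequence *)

Lemma return_time_uniq (R : realType) (T : R -> R) (J : set R) x k k' :
  is_return_time T J x k -> is_return_time T J x k' -> k = k'.
Proof.
move=> [k0 Jk nk] [k'0 Jk' nk']; have [kk'|k'k|//] := ltngtP k k'.
  by case: (nk' k); rewrite ?k0.
by case: (nk k'); rewrite ?k'0.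
Qed.

Lemma return_timeE (R : realType) (T : R -> R) (J : set R) x k :
  is_return_time T J x k -> return_time T J x = k.
Proof.
move=> rk; apply: return_time_uniq (rk).
by rewrite /return_time; case: xgetP => [k' _ //|/(_ k)].
Qed.

Section Visits.
Context (R : realType) (T : R -> R).

Definition visits (Q : set R) x m : nat := (\sum_(s < m) `[< Q (iter s T x) >])%N.

Lemma visitsD Q x m m' :
  visits Q x (m + m') = (visits Q x m + visits Q (iter m T x) m')%N.
Proof.
rewrite /visits big_split_ord /=; congr addn.
by apply: eq_bigr => s _; rewrite addnC iterD.
Qed.

Lemma eq_visits Q x y m :
  (forall s, (s < m)%N -> (Q (iter s T x) <-> Q (iter s T y))) ->
  visits Q x m = visits Q y m.
Proof.
move=> H; apply: eq_bigr => s _; congr (nat_of_bool _).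
by apply/asboolP/asboolP => /H; exact.
Qed.

End Visits.

Section Towers.
Context (R : realType) (n : nat) (T : R -> R).

(** The part of admissibility that survives composition: T is a translation up to
   the return time on each piece, and no reference is made to the pieces that the
   floors lie in.  The latter is [saturated], for one set at a time, so that
   visits to the pieces of every earlier level can be followed. *)
Record towers (a : R) (lam : 'rV[R]_n) (h : 'I_n -> nat) : Prop := Towers {
  towers_gt0 : positive_vector lam;
  towers_return : forall i x, piece a lam i x ->
    is_return_time T (hull a lam) x (h i);
  towers_transl : forall i x m, piece a lam i x -> (m <= h i)%N ->
    iter m T x = iter m T (endpoint a lam i) + (x - endpoint a lam i) }.

Definition saturated (a : R) (lam : 'rV[R]_n) (h : 'I_n -> nat) (Q : set R) :=
  forall i x m, piece a lam i x -> (m < h i)%N ->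
    (Q (iter m T x) <-> Q (iter m T (endpoint a lam i))).

Lemma towers_own_piece a lam h : towers a lam h -> forall j,
  saturated a lam h (piece a lam j) /\
  forall i : 'I_n, visits T (piece a lam j) (endpoint a lam i) (h i) = (j == i).
Proof.
move=> tw j; have lam0 := towers_gt0 tw.
have out (i : 'I_n) x m : piece a lam i x -> (0 < m < h i)%N -> ~ piece a lam j (iter m T x).
  by move=> ix mh; have [_ _ /(_ _ mh) nh] := towers_return tw ix; move=> /(piece_hull lam0).
split=> [i x [|m] ix mh|i].
- split=> /= jx.
    by rewrite (piece_uniq lam0 jx ix); exact: piece_left.
  by rewrite (piece_uniq lam0 jx (piece_left _ lam0 i)).
- by split=> h1; exfalso; [apply: (out i x m.+1 ix) h1|apply: (out i _ m.+1 (piece_left _ lam0 i)) h1]; rewrite mh.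
have [h0 _ _] := towers_return tw (piece_left a lam0 i).
rewrite /visits; case: (h i) (out i _ ^~ (piece_left a lam0 i)) h0 => // k outk _.
rewrite big_ord_recl big1 ?addn0 => [|s _] /=.
  congr nat_of_bool; apply/asboolP/eqP => [jx|<-]; last exact: piece_left.
  exact: piece_uniq jx (piece_left _ lam0 i).
apply/eqP; rewrite eqb0; apply/asboolPn.
by apply: (outk s.+1); rewrite /=; exact: ltn_ord.
Qed.

Section Compose.
Context (a : R) (lam : 'rV[R]_n) (h : 'I_n -> nat) (tw : towers a lam h).
Context (U : R -> R) (UT : forall i x, piece a lam i x -> U x = iter (h i) T x).
Context (a' : R) (lam' : 'rV[R]_n) (r : 'I_n -> nat).
Hypothesis adm : admissible_by U a lam (hull a' lam') a' lam' r.

Local Notation B := (visitation_matrix U a lam a' lam' r).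

Lemma itinerary i : exists idx : nat -> 'I_n,
  (forall x t, piece a' lam' i x -> (t < r i)%N -> piece a lam (idx t) (iter t U x)) /\
  forall f : 'I_n -> nat, (\sum_(t < r i) f (idx t) = \sum_j B j i * f j)%N.
Proof.
have [_ [lam'0 _] /(_ i) [_ _ sub]] := adm.
have lam0 := towers_gt0 tw.
have : forall t, exists j, (t < r i)%N ->
    forall x, piece a' lam' i x -> piece a lam j (iter t U x).
  move=> t; have [tr|rt] := ltnP t (r i); last by exists i.
  by have [j sj] := sub t tr; exists j => _ x ix; apply: sj; exists x.
move=> /choice[idx idxP]; exists idx; split=> [x t ix tr|f]; first exact: idxP.
rewrite (partition_big (fun t : 'I_(r i) => idx t) predT)//=.
apply: eq_bigr => j _; rewrite mxE.
rewrite (eq_bigr (fun=> f j)) => [|t /eqP->//].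
rewrite sum_nat_const; congr muln; apply: eq_card => t; rewrite !inE unfold_in.
apply/eqP/asboolP => [/val_inj<- y [x ix <-]|sj]; first exact: idxP.
apply: (congr1 val).
have ei := piece_left a' lam'0 i.
apply: (piece_uniq lam0 (idxP t (ltn_ord t) _ ei)).
by apply: sj; exists (endpoint a' lam' i).
Qed.

Definition composed_heights i : nat := (\sum_j B j i * h j)%N.

(** A tower for the composed induction is a stack of towers of the intermediate
   one, in the order of the itinerary. *)
Lemma compose_tower i x : piece a' lam' i x ->
  let e := endpoint a' lam' i in let m' := composed_heights i in
  [/\ iter (r i) U x = iter m' T x,
      forall m, (m <= m')%N -> iter m T x = iter m T e + (x - e),
      forall m, (0 < m < m')%N -> ~ hull a' lam' (iter m T x) &
      forall Q, saturated a lam h Q ->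
        (forall m, (m < m')%N -> (Q (iter m T x) <-> Q (iter m T e))) /\
        visits T Q e m' = (\sum_j B j i * visits T Q (endpoint a lam j) (h j))%N].
Proof.
move=> ix e m'; have [J'J [lam'0 _] /(_ i) [ret _ _]] := adm.
have lam0 := towers_gt0 tw.
have [idx [idxP idxS]] := itinerary i.
have ei : piece a' lam' i e by exact: piece_left.
pose H t := (\sum_(s < t) h (idx s))%N.
have HS t : H t.+1 = (H t + h (idx t))%N by rewrite /H big_ord_recr.
have main t : (t <= r i)%N -> forall x, piece a' lam' i x ->
  [/\ iter t U x = iter (H t) T x,
      forall m, (m <= H t)%N -> iter m T x = iter m T e + (x - e),
      forall m, (0 < m < H t)%N -> ~ hull a' lam' (iter m T x) &
      forall Q, saturated a lam h Q ->
        (forall m, (m < H t)%N -> (Q (iter m T x) <-> Q (iter m T e))) /\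
        visits T Q e (H t) =
          (\sum_(s < t) visits T Q (endpoint a lam (idx s)) (h (idx s)))%N].
  elim: t => [_ y iy|t IH tr y iy].
    rewrite /H big_ord0; split=> //.
    - by move=> m; rewrite leqn0 => /eqP->; rewrite /= addrC subrK.
    - by move=> m /andP[]; case: m.
    - by move=> Q sQ; split=> //; rewrite /visits !big_ord0.
  have [y1 y2 y3 y4] := IH (ltnW tr) y iy.
  have [e1 e2 e3 e4] := IH (ltnW tr) e ei.
  have jy := idxP y t iy tr; have je := idxP e t ei tr.
  set j := idx t in jy je HS *; set E := endpoint a lam j.
  have [h0 _ hout] := towers_return tw jy.
  have Uy : iter t.+1 U y = iter (H t.+1) T y.
    by rewrite iterS (UT jy) y1 -iterD addnC HS.
  have shift m : (m <= h j)%N -> iter (m + H t) T y = iter (m + H t) T e + (y - e).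
    move=> mh; rewrite !iterD -y1 -e1 (towers_transl tw jy mh) (towers_transl tw je mh).
    by rewrite y1 (y2 _ (leqnn _)) -e1; ring.
  have split_lt m P : (forall k, (k < H t)%N -> P k) ->
      (forall k, (k < h j)%N -> P (k + H t)%N) -> (m < H t.+1)%N -> P m.
    move=> P1 P2; rewrite HS => mlt; have [/P1//|Hm] := ltnP m (H t).
    by rewrite -(subnK Hm); apply: P2; rewrite -(ltn_add2r (H t)) subnK// addnC.
  split=> //.
  - move=> m mle; have [mH|Hm] := leqP m (H t); first exact: y2.
    by rewrite -(subnK (ltnW Hm)); apply: shift; rewrite leq_subLR -HS.
  - move=> m /andP[m0 mH]; pose P m := (0 < m)%N -> ~ hull a' lam' (iter m T y).
    apply: (split_lt m P _ _ mH) m0 => [k kH k0|]; first by apply: y3; rewrite k0.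
    move=> [|k] kh k0; last first.
      by rewrite iterD -y1 => /J'J; apply: hout; rewrite kh.
    rewrite add0n -y1; have [_ _ /(_ t)] := ret y iy; apply.
    by rewrite tr andbT lt0n; apply/negP => /eqP t0; move: k0; rewrite t0 /H big_ord0.
  - move=> Q sQ; have [y5 y6] := y4 Q sQ; split.
      move=> m; apply: (split_lt m (fun m => Q (iter m T y) <-> Q (iter m T e))) => // k kh.
      rewrite !iterD -y1 -e1; apply: iff_trans (sQ _ _ _ jy kh) _.
      exact: iff_sym (sQ _ _ _ je kh).
    rewrite HS visitsD y6 big_ord_recr /= -/j; congr addn.
    by rewrite -e1; apply: eq_visits => s sh; exact: sQ.
have [h1 h2 h3 h4] := main (r i) (leqnn _) x ix.
have HE : H (r i) = m' by rewrite /H idxS.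
rewrite HE in h1 h2 h3 h4; split=> // Q /h4[q1 q2]; split=> //.
by rewrite q2 (idxS (fun j => visits T Q (endpoint a lam j) (h j))).
Qed.

Lemma towers_compose : towers a' lam' composed_heights.
Proof.
have [J'J [lam'0 _] adm'] := adm; split=> // [i x ix|i x m ix]; last first.
  by have [_ + _ _] := compose_tower ix; exact.
have [h1 _ h3 _] := compose_tower ix; have [ret _ _] := adm' i.
have [r0 Jr _] := ret x ix; split=> //; last by rewrite -h1.
have [idx [idxP idxS]] := itinerary i.
rewrite /composed_heights -idxS; case: (r i) r0 idxP => // k _ idxP.
rewrite big_ord_recl addn_gt0; apply/orP; left.
by have [] := towers_return tw (idxP x 0%N ix isT).
Qed.

Lemma induced_compose i x : piece a' lam' i x ->
  induced U (hull a' lam') x = iter (composed_heights i) T x.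
Proof.
move=> ix; have [h1 _ _ _] := compose_tower ix.
have [_ _ /(_ i) [ret _ _]] := adm.
by rewrite /induced (return_timeE (ret x ix)).
Qed.

Lemma saturated_compose Q : saturated a lam h Q ->
  saturated a' lam' composed_heights Q /\
  forall i : 'I_n, visits T Q (endpoint a' lam' i) (composed_heights i) =
    (\sum_j B j i * visits T Q (endpoint a lam j) (h j))%N.
Proof.
move=> sQ; split=> [i x m ix mh|i].
  by have [_ _ _ /(_ Q sQ) [+ _]] := compose_tower ix; exact.
have [_ [lam'0 _] _] := adm.
by have [_ _ _ /(_ Q sQ) []] := compose_tower (piece_left a' lam'0 i).
Qed.

End Compose.
End Towers.

Section InductionSequence.
Context (R : realType) (n : nat) (T : R -> R) (B : nat -> 'M[nat]_n).

Definition nat_mx (A : 'M[nat]_n) : 'M[R]_n := map_mx (fun m => m%:R) A.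

Fixpoint heights (l : nat) (i : 'I_n) : nat :=
  if l is l'.+1 then (\sum_j B l j i * heights l' j)%N else 1%N.

Fixpoint visit_prod (k d : nat) : 'M[R]_n :=
  if d is d'.+1 then visit_prod k d' *m nat_mx (B (k + d'.+1)) else 1%:M.

Lemma visit_prodD k d d' :
  visit_prod k (d + d') = visit_prod k d *m visit_prod (k + d) d'.
Proof.
elim: d' => [|d' IH]; first by rewrite addn0 mulmx1.
by rewrite addnS /= IH mulmxA addnS addnA addnS.
Qed.

Context (J : nat -> set R) (a : nat -> R) (lam : nat -> 'rV[R]_n).
Context (r : nat -> 'I_n -> nat).
Hypothesis seqJ : admissible_induction_sequence T J a lam r.
Hypothesis BE : forall k, B k.+1 = visitation_matrix (iterated_induced T J k)
  (a k) (lam k) (a k.+1) (lam k.+1) (r k.+1).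
Hypothesis tw0 : towers T (a 0%N) (lam 0%N) (fun=> 1%N).

Lemma sequence_hull l : J l = hull (a l) (lam l).
Proof. by case: seqJ => J0 _ adm; case: l => // l; have [_ []] := adm l. Qed.

Lemma sequence_adm l : admissible_by (iterated_induced T J l) (a l) (lam l)
  (hull (a l.+1) (lam l.+1)) (a l.+1) (lam l.+1) (r l.+1).
Proof. by rewrite -sequence_hull; case: seqJ. Qed.

Lemma heightsE l i : heights l.+1 i = composed_heights (a l) (lam l) (heights l)
  (iterated_induced T J l) (a l.+1) (lam l.+1) (r l.+1) i.
Proof. by rewrite /= /composed_heights BE. Qed.

Lemma sequence_towers l : towers T (a l) (lam l) (heights l) /\
  forall i x, piece (a l) (lam l) i x ->
    iterated_induced T J l x = iter (heights l i) T x.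
Proof.
elim: l => [|l [tw UT]]; first by [].
have hE : heights l.+1 = composed_heights (a l) (lam l) (heights l)
  (iterated_induced T J l) (a l.+1) (lam l.+1) (r l.+1).
  by apply/funext => i; exact: heightsE.
rewrite hE; split; first exact: (towers_compose tw UT (sequence_adm l)).
move=> i x ix /=; rewrite sequence_hull.
exact: (induced_compose tw UT (sequence_adm l)).
Qed.

Lemma sequence_visits k d :
  (forall j, saturated T (a (k + d)%N) (lam (k + d)%N) (heights (k + d))
    (piece (a k) (lam k) j)) /\
  forall i j : 'I_n, (visits T (piece (a k) (lam k) j)
    (endpoint (a (k + d)%N) (lam (k + d)%N) i) (heights (k + d) i))%:R =
    visit_prod k d j i.
Proof.
elim: d => [|d [sat IH]].
  rewrite addn0; have [tw _] := sequence_towers k; split=> [j|i j].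
    by have [] := towers_own_piece tw j.
  by have [_ ->] := towers_own_piece tw j; rewrite mxE.
have [tw UT] := sequence_towers (k + d).
have hE : heights (k + d).+1 = composed_heights (a (k + d)%N) (lam (k + d)%N)
  (heights (k + d)) (iterated_induced T J (k + d))
  (a (k + d).+1) (lam (k + d).+1) (r (k + d).+1).
  by apply/funext => i; exact: heightsE.
rewrite addnS; split=> [j|i j].
  by rewrite hE; have [] := saturated_compose tw UT (sequence_adm (k + d)) (sat j).
rewrite hE; have [_ ->] := saturated_compose tw UT (sequence_adm (k + d)) (sat j).
rewrite -BE /= addnS mxE natr_sum; apply: eq_bigr => l _.
by rewrite natrM IH mulrC [nat_mx _ _ _]mxE.
Qed.

End InductionSequence.

(** * The translation form under induction *)

(** N k j stands for: the image of piece k lies to the left of that of piece j.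
   Applied to the lengths, this matrix gives the translations. *)
Definition translation_mx (R : pzRingType) (n : nat) (N : rel 'I_n) : 'M[R]_n :=
  \matrix_(j, k) ((N k j)%:R - (k < j)%N%:R).

Lemma endpoint_ltE (R : realType) (n : nat) (a : R) (lam : 'rV[R]_n) :
  positive_vector lam -> forall i j : 'I_n,
  (endpoint a lam i < endpoint a lam j) = (i < j)%N.
Proof.
move=> lam0 i j; have [ij|ji] := ltnP i j; first by rewrite endpoint_lt.
by apply/negbTE; rewrite -leNgt endpoint_le.
Qed.

Section TowerCounts.
Context (R : realType) (n : nat) (T : R -> R).
Context (a : R) (lam : 'rV[R]_n) (lam0 : positive_vector lam).
Context (N : rel 'I_n) (Nirr : irreflexive N).
Hypothesis T_lt : forall (j k : 'I_n) x y, piece a lam j x -> piece a lam k y ->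
  (T x < T y) = if j == k then x < y else N j k.
Hypothesis T_hull : forall x, hull a lam x -> hull a lam (T x).
Context (a' : R) (lam' : 'rV[R]_n) (h : 'I_n -> nat) (tw : towers T a' lam' h).
Hypothesis sub : hull a' lam' `<=` hull a lam.

Local Notation e := (endpoint a' lam').

Definition visit_mx : 'M[R]_n :=
  \matrix_(j, i) (visits T (piece a lam j) (e i) (h i))%:R.

Definition return_order : rel 'I_n :=
  fun k i => iter (h k) T (e k) < iter (h i) T (e i).

(** Putting a unit mass at the left end of each floor of tower l, these are the
   distribution functions of that measure and of its image under T.  Masses at
   points need no information on how the floors are arranged. *)
Definition floors_left (l : 'I_n) (x : R) : R :=
  \sum_(m < h l) (iter m T (e l) < x)%R%:R.
Definition images_left (l : 'I_n) (x : R) : R :=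
  \sum_(m < h l) (iter m.+1 T (e l) < x)%R%:R.

Let lam'0 : positive_vector lam' := towers_gt0 tw.

Lemma iter_hull m x : hull a lam x -> hull a lam (iter m T x).
Proof. by move=> hx; elim: m => //= m; exact: T_hull. Qed.

Lemma left_end_hull (i : 'I_n) : hull a' lam' (e i).
Proof. exact: (piece_hull lam'0 (piece_left _ lam'0 i)). Qed.

Lemma top_hull (i : 'I_n) : hull a' lam' (iter (h i) T (e i)).
Proof. by have [] := towers_return tw (piece_left _ lam'0 i). Qed.

Lemma floor_outside (i : 'I_n) m : (0 < m < h i)%N -> ~ hull a' lam' (iter m T (e i)).
Proof. by have [_ _] := towers_return tw (piece_left _ lam'0 i); exact. Qed.

Lemma height_gt0 i : (0 < h i)%N.
Proof. by have [] := towers_return tw (piece_left _ lam'0 i). Qed.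

Lemma sum_visits (f : 'I_n -> R) i (g : nat -> R) :
  (forall j m, (m < h i)%N -> piece a lam j (iter m T (e i)) -> g m = f j) ->
  \sum_(m < h i) g m = \sum_j f j * visit_mx j i.
Proof.
move=> gf; under [RHS]eq_bigr => j _.
  by rewrite mxE /visits natr_sum mulr_sumr; over.
rewrite exchange_big /=; apply: eq_bigr => m _.
have [j jm] := piece_cover (iter_hull m (sub (left_end_hull i))).
rewrite (bigD1 j)//= big1 => [|k kj].
  by rewrite addr0 asboolT// mulr1; exact: gf.
by rewrite asboolF ?mulr0// => /(piece_uniq lam0 jm) jk; rewrite jk eqxx in kj.
Qed.

(** T preserves the order inside a piece and permutes the pieces by N, so the
   mass to the left changes by the mass of the pieces that cross. *)
Lemma images_floors_left l j x : piece a lam j x ->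
  images_left l (T x) - floors_left l x = (translation_mx R N *m visit_mx) j l.
Proof.
move=> jx; rewrite mxE -sumrB.
apply: (sum_visits (f := translation_mx R N j)
  (g := fun m => (iter m.+1 T (e l) < T x)%R%:R - (iter m T (e l) < x)%R%:R)).
move=> k m _ km; rewrite mxE iterS (T_lt km jx); case: eqVneq => [->|kj].
  by rewrite Nirr ltnn !subrr.
congr (_ - (nat_of_bool _)%:R); move: km jx; rewrite !pieceE.
have [kj'|jk'|/val_inj ejk] := ltngtP k j; last by rewrite ejk eqxx in kj.
  by have := endpoint_le a lam0 kj'; lra.
by have := endpoint_le a lam0 jk' => h1 h2 h3; apply/negbTE; rewrite -leNgt; lra.
Qed.

(** The measure and its image share all floors except the base and the image of
   the top, which both lie in the base interval. *)
Lemma images_leftE l y : images_left l y =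
  floors_left l y + ((iter (h l) T (e l) < y)%R%:R - (e l < y)%R%:R).
Proof.
rewrite /images_left /floors_left; elim: (h l) => [|m IH].
  by rewrite !big_ord0 /= subrr addr0.
by rewrite !big_ord_recr /= IH; ring.
Qed.

Lemma images_left_outside l y : (y <= a') || ~~ `[< hull a' lam' y >] ->
  images_left l y = floors_left l y.
Proof.
move=> ya; rewrite images_leftE.
suff -> : (iter (h l) T (e l) < y) = (e l < y) by rewrite subrr addr0.
have := left_end_hull l; have := top_hull l; rewrite !hullE => h1 h2.
case/orP: ya => [ya|/asboolPn].
  by rewrite !ltNge !(le_trans ya)//; [case/andP: h2|case/andP: h1].
rewrite hullE => yJ; have [ya|ay] := ltP y a'.
  by rewrite !ltNge !(le_trans (ltW ya))//; [case/andP: h2|case/andP: h1].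
have ey : endpoint a' lam' n <= y by rewrite leNgt; apply/negP => yn; apply: yJ; rewrite ay.
by rewrite (lt_le_trans _ ey) ?(lt_le_trans _ ey)//; [case/andP: h2|case/andP: h1].
Qed.

Lemma floors_left_base l x y : hull a' lam' x -> hull a' lam' y ->
  floors_left l y - floors_left l x = (e l < y)%R%:R - (e l < x)%R%:R.
Proof.
move=> hx hy; rewrite /floors_left; have := @floor_outside l.
case: (h l) (height_gt0 l) => // k _ out.
rewrite !big_ord_recl /= -[RHS]addr0; set s := \sum_i _; set s' := \sum_i _.
suff -> : s = s' by ring.
apply: eq_bigr => m _; congr (nat_of_bool _)%:R.
have : ~ hull a' lam' (iter m.+1 T (e l)) by apply: out; rewrite /=; exact: ltn_ord.
rewrite hullE /= => nJ; rewrite add0n; move: hx hy; rewrite !hullE => hx hy.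
set p := T _ in nJ *; have [pa|ap] := ltP p a'.
  by rewrite (lt_le_trans pa) ?(lt_le_trans pa)//; [case/andP: hx|case/andP: hy].
have ep : endpoint a' lam' n <= p by rewrite leNgt; apply/negP => yn; apply: nJ; rewrite ap.
by rewrite !ltNge (ltW (lt_le_trans _ ep)) ?(ltW (lt_le_trans _ ep))//; [case/andP: hx|case/andP: hy].
Qed.

Lemma floors_left_break l (j : 'I_n) :
  floors_left l (endpoint a lam j) = \sum_(k < n | (k < j)%N) visit_mx k l.
Proof.
rewrite big_mkcond /=.
under eq_bigr => k _ do rewrite -mulrb -mulr_natl.
apply: (sum_visits (f := fun k : 'I_n => (k < j)%N%:R)
  (g := fun m => (iter m T (e l) < endpoint a lam j)%R%:R)).
move=> k m _; rewrite pieceE => km; congr (nat_of_bool _)%:R.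
have [kj|jk] := ltnP k j; first by have := endpoint_le a lam0 kj; lra.
by have := endpoint_le a lam0 jk => h1; apply/negbTE; rewrite -leNgt; lra.
Qed.

(** Summing [images_floors_left] along a tower telescopes, because the two
   distribution functions agree outside the base interval. *)
Theorem translation_mx_induced :
  visit_mx^T *m translation_mx R N *m visit_mx = translation_mx R return_order.
Proof.
apply/matrixP => i l; rewrite -mulmxA mxE [RHS]mxE.
set M := translation_mx R N *m visit_mx.
under eq_bigr => j _ do rewrite mxE mulrC.
pose x s := iter s T (e i).
rewrite -(@sum_visits (fun j => M j l) i
  (fun s => images_left l (x s.+1) - floors_left l (x s))); last first.
  by move=> j m mh jm; rewrite -(images_floors_left l jm).
have tel k : (0 < k <= h i)%N ->
    \sum_(s < k) (images_left l (x s.+1) - floors_left l (x s)) =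
    images_left l (x k) - floors_left l (x 0%N).
  elim: k => // -[_ _|k IH]; first by rewrite big_ord_recl big_ord0 addr0.
  move=> /andP[_ kh]; rewrite big_ord_recr IH /=; last by rewrite ltnW.
  rewrite [images_left l (x k.+1)]images_left_outside; first by ring.
  by apply/orP; right; apply/asboolPn; apply: floor_outside; rewrite kh.
rewrite tel ?leqnn ?height_gt0// images_leftE.
have := floors_left_base l (left_end_hull i) (top_hull i) => E.
rewrite /return_order -(endpoint_ltE a' lam'0) /x /=; move: E.
set F1 := floors_left l _; set F2 := floors_left l _ => E.
have -> : F1 = F2 + ((e l < iter (h i) T (e i))%R%:R - (e l < e i)%R%:R) by rewrite -E; ring.
ring.
Qed.

End TowerCounts.

(** * Kernel vectors of the translation form *)

Lemma endpoint_shift (R : realType) (n : nat) (c : R) (w : 'rV[R]_n) j :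
  endpoint c w j = c + endpoint 0 w j.
Proof. by rewrite /endpoint add0r. Qed.

Lemma endpoints_const (R : realType) (n : nat) (c : R) (w : 'rV[R]_n) :
  (forall i : 'I_n, endpoint c w i = 0) -> forall k : 'I_n, (k.+1 < n)%N -> w 0 k = 0.
Proof.
move=> w0 k kn; have := endpointS c w k.
by rewrite (w0 k) (w0 (Ordinal kn)) add0r.
Qed.

Section Kernel.
Context (R : realType) (n : nat) (pi : 'S_n) (lam : 'rV[R]_n).
Hypotheses (lam0 : positive_vector lam) (n2 : (2 <= n)%N).
Hypotheses (irr : irreducible_perm pi) (free : idoc pi lam).
Local Notation T := (iet pi lam).
Context (a' : R) (lam' : 'rV[R]_n) (h : 'I_n -> nat) (tw : towers T a' lam' h).
Hypothesis sub : hull a' lam' `<=` hull 0 lam.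
Hypothesis sat : forall j, saturated T a' lam' h (piece 0 lam j).

Local Notation be := (endpoint 0 lam).
Local Notation L := (be n).
Local Notation e := (endpoint a' lam').
Local Notation V := (visit_mx T 0 lam a' lam' h).

Definition perm_order : rel 'I_n := fun k j => (pi k < pi j)%N.
Local Notation Om := (translation_mx R perm_order).

Let kT := idoc_keane lam0 n2 irr free.
Let lam'0 : positive_vector lam' := towers_gt0 tw.

Lemma perm_order_irr : irreflexive perm_order.
Proof. by move=> i; rewrite /perm_order ltnn. Qed.

Lemma iet_hull x : hull 0 lam x -> hull 0 lam (T x).
Proof. by rewrite !hull0E; exact: iet_dom. Qed.

Lemma iet_perm_lt (j k : 'I_n) x y : piece 0 lam j x -> piece 0 lam k y ->
  (T x < T y) = if j == k then x < y else perm_order j k.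
Proof. exact: iet_lt. Qed.

Lemma floor_dom m (i : 'I_n) : 0 <= iter m T (e i) < L.
Proof.
by apply: (iter_dom kT); rewrite -hull0E; apply: sub; apply: left_end_hull tw _.
Qed.

Lemma towers_cover x : 0 <= x < L ->
  exists i m y, [/\ (m < h i)%N, piece a' lam' i y & iter m T y = x].
Proof.
move=> xL; have n0 : (0 < n)%N by exact: ltnW.
have a'e : a' < e n.
  by have := endpoint_lt a' lam'0 (j := Ordinal n0) n0; rewrite endpoint0.
have a'0 : 0 <= a' by have := @sub a'; rewrite hull0E hullE lexx a'e => /(_ isT)/andP[].
have eL : e n <= L.
  rewrite leNgt; apply/negP => Le; pose z := Num.max a' L.
  have := @sub z; rewrite hull0E hullE /z le_max lexx gt_max a'e Le => /(_ isT).
  by rewrite gt_max ltxx !andbF.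
have [M /(_ x xL)[_ [m [y [_ ya ymx]]]]] := keane_minimal kT a'0 a'e eL.
have [|k [z [za zx]] kmin] := @least_witness (fun m => exists y, hull a' lam' y /\ iter m T y = x).
  by exists m, y; rewrite hullE.
have [i iz] := piece_cover za; exists i, k, z; split=> //.
have [h0 hz _] := towers_return tw iz.
rewrite ltnNge; apply/negP => hk; apply: (kmin (k - h i)%N).
  by rewrite ltn_subrL h0 (leq_trans h0).
by exists (iter (h i) T z); split=> //; rewrite -iterD subnK.
Qed.

(** A floor that contains a break lies in the piece that starts there. *)
Lemma break_left_end (j : 'I_n) :
  exists i : 'I_n, exists2 m, (m < h i)%N & iter m T (e i) = be j.
Proof.
have bj := piece_left 0 lam0 j.
have [|i [m [y [mh iy yb]]]] := @towers_cover (be j).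
  by rewrite -hull0E; exact: piece_hull bj.
exists i; exists m => //; rewrite -yb in bj.
have := (sat j iy mh).1 bj; have := towers_transl tw iy (ltnW mh).
by move: iy; rewrite yb !pieceE; lra.
Qed.

(** The preimage of the left end of the base lies in a top floor, and the image
   of that floor stays in the base, so it starts there. *)
Lemma base_left_end :
  exists i : 'I_n, iter (h i) T (e i) = a'.
Proof.
have n0 : (0 < n)%N by exact: ltnW.
have a'J : hull a' lam' a'.
  by have := left_end_hull tw (Ordinal n0); rewrite endpoint0.
have a'L : 0 <= a' < L by rewrite -hull0E; exact: sub.
have [z zL za] := keane_surj kT a'L.
have [i [m [y [mh iy yz]]]] := towers_cover zL.
have ya : iter m.+1 T y = a' by rewrite iterS yz.
have [h0 hy out] := towers_return tw iy.
have hm : h i = m.+1.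
  apply/eqP; rewrite eqn_leq mh andbT leqNgt; apply/negP => mh'.
  by apply: (out m.+1); rewrite ?mh' // ya.
exists i; have := towers_transl tw iy (leqnn _); rewrite {1}hm ya.
by have := top_hull tw i; move: iy; rewrite pieceE hullE; lra.
Qed.

Definition hit (i : 'I_n) :=
  exists j : 'I_n, (0 < j)%N /\ exists2 m, (m < h i)%N & iter m T (e i) = be j.

Lemma be_break (j : 'I_n) : (0 < j)%N -> be j \in breaks lam.
Proof. by move=> j0; apply/breaksP; exists j. Qed.

(** The n - 1 breaks have pairwise distinct orbits, hence sit in distinct
   towers. *)
Lemma hit_all_but_one i i' : ~ hit i -> ~ hit i' -> i = i'.
Proof.
move=> ni ni'; apply: contrapT => ii'.
have [f fP] := choice break_left_end.
have finj : {in [set j : 'I_n | (0 < j)%N]%SET &, injective f}.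
  move=> j j'; rewrite !inE => j0 j'0 fjj.
  have [m _ mb] := fP j; have [m' _ mb'] := fP j'; rewrite fjj in mb.
  have nofree (k k' : 'I_n) s s' : (0 < k)%N -> (0 < k')%N -> (s < s')%N ->
      iter s T (e (f j')) = be k -> iter s' T (e (f j')) = be k' -> False.
    move=> k0 k'0 ss' sk sk'; have [d dE] := subn_succ ss'.
    apply: (keane_no_connection kT (s := d) (be_break k0) (be_break k'0)).
    by rewrite -sk -iterD -dE subnK// ltnW.
  have [mm'|m'm|mm'] := ltngtP m m'.
  - by case: (nofree j j' m m').
  - by case: (nofree j' j m' m).
  have bb : be j = be j' by rewrite -mb -mb' mm'.
  have := @endpoint_ltE _ _ 0 lam lam0 j j'; have := @endpoint_ltE _ _ 0 lam lam0 j' j.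
  rewrite bb ltxx => h1 h2; apply: val_inj => /=; apply/eqP.
  by rewrite eqn_leq leqNgt -h1 leqNgt -h2.
have := card_in_imset finj; set S := [set j : 'I_n | (0 < j)%N]%SET => cS.
have n0 : (0 < n)%N by exact: ltnW.
have SE : S = (~: [set Ordinal n0])%SET.
  by apply/setP => j; rewrite !inE -(inj_eq val_inj) /= lt0n.
have : (f @: S \subset ~: [set i; i'])%SET.
  apply/fintype.subsetP => k /imsetP[j]; rewrite !inE => j0 kE; apply/negP => /orP[] /eqP ki.
    by apply: ni; exists j; split=> //; rewrite -ki kE.
  by apply: ni'; exists j; split=> //; rewrite -ki kE.
move=> /subset_leq_card; rewrite cS SE.
have := cardsC [set Ordinal n0]%SET; have := cardsC [set i; i']%SET.
rewrite cards1 cards2 card_ord (introN eqP ii') => h1 h2; lia.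
Qed.

Section KernelVector.
Context (w : 'cV[R]_n) (ker : Om *m V *m w = 0).

(* Distribution functions of the point masses with weights w. *)
Let F x := \sum_l floors_left T a' lam' h l x * w l 0.
Let G x := \sum_l images_left T a' lam' h l x * w l 0.

(** The mass that crosses x under T is an entry of Omega A w, hence 0. *)
Lemma kernel_step x : 0 <= x < L -> G (T x) = F x.
Proof.
move=> xL; have [j jx] := @piece_cover _ _ 0 lam x (eq_ind_r id xL (hull0E lam x)).
apply/eqP; rewrite -subr_eq0 /G /F -sumrB; apply/eqP.
transitivity ((Om *m V *m w) j 0); last by rewrite ker mxE.
rewrite [RHS]mxE; apply: eq_bigr => l _; rewrite -mulrBl.
by rewrite (images_floors_left lam0 perm_order_irr iet_perm_lt iet_hull tw sub l jx).
Qed.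

Lemma kernel_outside y : (y <= a') || ~~ `[< hull a' lam' y >] -> G y = F y.
Proof.
by move=> ya; rewrite /G /F; apply: eq_bigr => l _; rewrite (images_left_outside tw).
Qed.

Lemma kernel_floor (i : 'I_n) m : (m < h i)%N -> F (iter m T (e i)) = F (e i).
Proof.
elim: m => // m IH mh; rewrite -IH; last exact: ltnW.
rewrite -(kernel_step (floor_dom m i)) -iterS kernel_outside//.
by apply/orP; right; apply/asboolPn; apply: (floor_outside tw).
Qed.

Lemma kernel_base (i : 'I_n) : F (e i) = endpoint (F a') w^T i.
Proof.
have n0 : (0 < n)%N by exact: ltnW.
have e0 : a' = e (Ordinal n0) by rewrite endpoint0.
have -> : endpoint (F a') w^T i = F a' + \sum_(l < n | (l < i)%N) w^T 0 l by [].
rewrite -[LHS](subrKC (F a')); congr (_ + _); rewrite /F -sumrB [RHS]big_mkcond /=.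
apply: eq_bigr => l _; rewrite -mulrBl mxE.
have := floors_left_base tw l (left_end_hull tw (Ordinal n0)) (left_end_hull tw i).
rewrite !(endpoint_ltE a' lam'0) -e0 ltn0 subr0 => ->.
by case: ltnP => _; rewrite ?mul1r ?mul0r.
Qed.

Lemma kernel_break (j : 'I_n) : F (be j) = endpoint 0 (V *m w)^T j.
Proof.
have -> : endpoint 0 (V *m w)^T j = \sum_(k < n | (k < j)%N) (V *m w)^T 0 k.
  by rewrite /endpoint add0r.
rewrite /F; under [RHS]eq_bigr => k _ do rewrite mxE mxE.
rewrite exchange_big /=; apply: eq_bigr => l _.
by rewrite (floors_left_break lam0 iet_hull tw sub) mulr_suml.
Qed.

Lemma kernel_hit (i : 'I_n) : hit i -> exists j : 'I_n, F (e i) = F (be j).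
Proof. by move=> [j [_ [m mh mb]]]; exists j; rewrite -mb kernel_floor. Qed.

(** Only one tower can fail to contain a break.  If neither the first tower nor
   the one whose top returns to the left end of the base failed, the orbit through
   that left end would connect two breaks.  So the exceptional tower is one of
   these two, and invariance gives both the same value. *)
Lemma kernel_base_hit (i : 'I_n) : exists j : 'I_n, F (e i) = F (be j).
Proof.
have n0 : (0 < n)%N by exact: ltnW.
have e0 : a' = e (Ordinal n0) by rewrite endpoint0.
have [|ni] := pselect (hit i); first exact: kernel_hit.
have [i1 top1] := base_left_end.
set i0 := Ordinal n0 in e0 *.
have i01 : i1 != i0.
  apply/eqP => ii; rewrite ii -e0 in top1.
  have a'L : 0 <= a' < L by rewrite e0; exact: (floor_dom 0).
  move: top1; have := height_gt0 tw i0; case: (h i0) => // k _.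
  exact: (keane_aperiodic kT a'L).
have F01 : F (e i1) = F (e i0).
  have h0 := height_gt0 tw i1.
  rewrite -(@kernel_floor i1 (h i1).-1) ?ltn_predL// -(kernel_step (floor_dom _ _)).
  by rewrite -iterS prednK// top1 -e0 kernel_outside ?lexx.
have [hit0|nhit0] := pselect (hit i0).
  have [[j1 [j10 [m1 mh1 mb1]]]|nhit1] := pselect (hit i1).
    have [j0 [j00 [m0 mh0 mb0]]] := hit0.
    have [d dE] := subn_succ mh1.
    exfalso; apply: (keane_no_connection kT (s := (m0 + d)%N) (be_break j10) (be_break j00)).
    by rewrite -mb1 -addnS -dE iterD -(iterD (h i1 - m1)) subnK ?(ltnW mh1)// top1 e0.
  rewrite (hit_all_but_one ni nhit1) F01; exact: kernel_hit.
rewrite (hit_all_but_one ni nhit0) -F01; apply: kernel_hit.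
by apply: contrapT => nhit1; move/eqP: i01; apply; exact: hit_all_but_one.
Qed.

(** Both sides list the values of one function, at the left ends of the original
   pieces and at those of the base pieces; the function is constant on the left
   ends of the floors of a tower. *)
Theorem kernel_partial_sums : exists c : R,
  (forall j : 'I_n, exists i : 'I_n, endpoint 0 (V *m w)^T j = endpoint c w^T i) /\
  (forall i : 'I_n, exists j : 'I_n, endpoint c w^T i = endpoint 0 (V *m w)^T j).
Proof.
exists (F a'); split=> [j|i].
  have [i [m mh mb]] := break_left_end j; exists i.
  by rewrite -kernel_break -mb kernel_floor// kernel_base.
have [j ij] := kernel_base_hit i; exists j.
by rewrite -kernel_break -ij kernel_base.
Qed.

End KernelVector.

(** Irreducibility gives the last partial sum: the row of the piece whose image
   comes last expresses it by an earlier one. *)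
Lemma kernel_endpoints_const (z : 'cV[R]_n) :
  Om *m z = 0 -> (forall j : 'I_n, endpoint 0 z^T j = 0) -> z = 0.
Proof.
move=> kz z0.
have zk (k : 'I_n) : (k.+1 < n)%N -> z k 0 = 0.
  by move=> kn; have := endpoints_const z0 kn; rewrite mxE.
have n0 : (0 < n)%N by exact: ltnW.
have last_lt : (n.-1 < n)%N by rewrite prednK.
pose nl := Ordinal last_lt.
pose jl := (pi^-1)%g nl.
have pjl : pi jl = n.-1 :> nat by rewrite permKV.
have jln := irreducible_preimage_last n2 irr pjl.
have := congr1 (fun A : 'cV_n => A jl 0) kz; rewrite [RHS]mxE mxE => row.
have tot : \sum_k z k 0 = endpoint 0 z^T jl.+1.
  rewrite endpointS z0 add0r [z^T _ _]mxE (bigD1 jl)//=.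
  suff -> : \sum_(i | i != jl) z i 0 = 0 by rewrite addr0.
  have before0 : \sum_(k < n) (k < jl)%N%:R * z k 0 = 0.
    rewrite -[RHS](z0 jl).
    have -> : endpoint 0 z^T jl = \sum_(k < n | (k < jl)%N) z^T 0 k.
      by rewrite /endpoint add0r.
    rewrite [RHS]big_mkcond; apply: eq_bigr => k _; rewrite mxE.
    by case: ltnP; rewrite ?mul1r ?mul0r.
  rewrite -[RHS]row -[RHS]addr0 -[X in _ + X]before0 -big_split /= big_mkcond.
  apply: eq_bigr => k _; rewrite [Om _ _]mxE mulrBl subrK /perm_order pjl.
  have -> : (pi k < n.-1)%N = (k != jl).
    rewrite -(inj_eq (@perm_inj _ pi)) -(inj_eq val_inj) /= pjl.
    by have := ltn_ord (pi k); move: n0; clear; lia.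
  by case: (k != jl); rewrite ?mul1r ?mul0r.
have {}tot : \sum_k z k 0 = 0 by rewrite tot; exact: (z0 (Ordinal jln)).
apply/matrixP => k o; rewrite (ord1 o) mxE.
have [/zk//|nk] := ltnP k.+1 n.
have kl : k = nl by apply: val_inj => /=; have := ltn_ord k; move: nk; clear; lia.
move: tot; rewrite (bigD1 nl)//= big1 ?addr0 ?kl// => i il; apply: zk.
move: il; rewrite -(inj_eq val_inj) /=; have := ltn_ord i; clear; lia.
Qed.

(** The partial sums of fewer than n entries of a vector with image 0 are
   constant, so only the last entry can be nonzero; and no column of the visitation
   matrix vanishes. *)
Lemma visit_mx_inj (w : 'cV[R]_n) : V *m w = 0 -> w = 0.
Proof.
move=> Vw; have ker : Om *m V *m w = 0 by rewrite -mulmxA Vw mulmx0.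
have [c [_ cw]] := kernel_partial_sums ker.
have {}cw (i : 'I_n) : endpoint c w^T i = 0.
  have [j ->] := cw i; rewrite Vw /endpoint add0r big1// => k _.
  by rewrite !mxE.
have wk (k : 'I_n) : (k.+1 < n)%N -> w k 0 = 0.
  by move=> kn; have := endpoints_const cw kn; rewrite mxE.
have n0 : (0 < n)%N by exact: ltnW.
have last_lt : (n.-1 < n)%N by rewrite prednK.
pose nl := Ordinal last_lt.
have wl : w nl 0 = 0.
  have [j jnl] := piece_cover (sub (left_end_hull tw nl)).
  have := congr1 (fun A : 'cV_n => A j 0) Vw; rewrite [RHS]mxE mxE (bigD1 nl)//=.
  rewrite big1 ?addr0 => [|i il]; last first.
    rewrite wk ?mulr0//; move: il; rewrite -(inj_eq val_inj) /=.
    by have := ltn_ord i; clear; lia.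
  move=> /eqP; rewrite mulf_eq0 => /orP[|/eqP//].
  rewrite mxE pnatr_eq0 /visits; have := height_gt0 tw nl.
  by case: (h nl) => // k _; rewrite big_ord_recl /= asboolT.
apply/matrixP => k o; rewrite (ord1 o) mxE.
have [/wk//|nk] := ltnP k.+1 n.
by have -> : k = nl by apply: val_inj => /=; have := ltn_ord k; move: nk; clear; lia.
Qed.

End Kernel.

(** * Growth of the towers and positivity of the products *)

Lemma unitmx_inj (F : fieldType) (n : nat) (A : 'M[F]_n) :
  (forall w : 'cV[F]_n, A *m w = 0 -> w = 0) -> A \in unitmx.
Proof.
move=> Ainj; rewrite -unitmx_tr -row_free_unit -kermx_eq0.
apply/eqP/row_matrixP => i; rewrite row0.
have K0 : row i (kermx A^T) *m A^T = 0 by rewrite -row_mul mulmx_ker row0.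
apply: trmx_inj; rewrite trmx0; apply: Ainj.
by apply: trmx_inj; rewrite trmx_mul trmxK trmx0.
Qed.

Section VisitBounds.
Context (R : realType) (T : R -> R) (Q : set R) (x : R).

Lemma visits_le m : (visits T Q x m <= m)%N.
Proof.
rewrite -[leqRHS]card_ord -sum1_card; apply: leq_sum => s _.
by case: (`[< _ >]).
Qed.

Lemma visits_gt0 s m : (s < m)%N -> Q (iter s T x) -> (0 < visits T Q x m)%N.
Proof. by move=> sm Qs; rewrite /visits (bigD1 (Ordinal sm))//= asboolT. Qed.

Lemma visits_gt1 s s' m : (s < s')%N -> (s' < m)%N ->
  Q (iter s T x) -> Q (iter s' T x) -> (1 < visits T Q x m)%N.
Proof.
move=> ss' s'm Qs Qs'; have sm := ltn_trans ss' s'm.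
rewrite /visits (bigD1 (Ordinal sm))//= asboolT// (bigD1 (Ordinal s'm))/=.
  by rewrite asboolT.
by rewrite -(inj_eq val_inj) /= gtn_eqF.
Qed.

End VisitBounds.

Section MinimalInduction.
Context (R : realType) (n : nat) (pi : 'S_n) (lam0 : 'rV[R]_n).
Hypotheses (lam0_gt0 : positive_vector lam0) (n2 : (2 <= n)%N).
Hypotheses (irr : irreducible_perm pi) (free : idoc pi lam0).
Local Notation T := (iet pi lam0).
Context (B : nat -> 'M[nat]_n) (J : nat -> set R) (a : nat -> R).
Context (lam : nat -> 'rV[R]_n) (r : nat -> 'I_n -> nat).
Hypotheses (a0 : a 0%N = 0) (lam_0 : lam 0%N = lam0).
Hypothesis seqJ : admissible_induction_sequence T J a lam r.
Hypothesis BE : forall k, B k.+1 = visitation_matrix (iterated_induced T J k)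
  (a k) (lam k) (a k.+1) (lam k.+1) (r k.+1).

Local Notation h := (heights B).
Local Notation P := (visit_prod R B).
Local Notation e l := (endpoint (a l) (lam l)).
Local Notation L := (endpoint 0 lam0 n).

Let kT := idoc_keane lam0_gt0 n2 irr free.

Lemma iet_unit_towers : towers T 0 lam0 (fun=> 1%N).
Proof.
split=> // [i x ix|i x m ix].
  split=> //; last by move=> m /andP[]; case: m.
  by apply: iet_hull => //; exact: piece_hull ix.
case: m => [|[|//]] _ /=; first by rewrite addrC subrK.
by rewrite (iet_on_piece _ lam0_gt0 ix) (iet_on_piece _ lam0_gt0 (piece_left 0 lam0_gt0 i)); ring.
Qed.

Let tw0 : towers T (a 0%N) (lam 0%N) (fun=> 1%N).
Proof. by rewrite a0 lam_0; exact: iet_unit_towers. Qed.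

Lemma level_towers l : towers T (a l) (lam l) (h l).
Proof. by have [] := sequence_towers seqJ BE tw0 l. Qed.

Lemma level_gt0 l : positive_vector (lam l).
Proof. exact: towers_gt0 (level_towers l). Qed.

Lemma level_nested k d : hull (a (k + d)%N) (lam (k + d)%N) `<=` hull (a k) (lam k).
Proof.
elim: d => [|d IH]; first by rewrite addn0.
rewrite addnS; apply: subset_trans IH; rewrite -!(sequence_hull seqJ).
by case: seqJ => _ /(_ (k + d)%N)/properW.
Qed.

Lemma level_sub l : hull (a l) (lam l) `<=` hull 0 lam0.
Proof. by have := @level_nested 0%N l; rewrite add0n a0 lam_0. Qed.

Lemma level_saturated k d j : saturated T (a (k + d)%N) (lam (k + d)%N)
  (h (k + d)) (piece (a k) (lam k) j).
Proof. by have [] := sequence_visits seqJ BE tw0 k d. Qed.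

Lemma level_visits k d (i j : 'I_n) : P k d j i =
  (visits T (piece (a k) (lam k) j) (e (k + d)%N i) (h (k + d) i))%:R.
Proof. by have [_ ->] := sequence_visits seqJ BE tw0 k d. Qed.

Lemma level_saturated0 l j : saturated T (a l) (lam l) (h l) (piece 0 lam0 j).
Proof. by have := @level_saturated 0%N l j; rewrite add0n a0 lam_0. Qed.

Lemma level_visit_mx l : P 0%N l = visit_mx T 0 lam0 (a l) (lam l) (h l).
Proof.
by apply/matrixP => j i; rewrite level_visits mxE add0n a0 lam_0.
Qed.

Lemma visit_prod_unit l : P 0%N l \in unitmx.
Proof.
apply: unitmx_inj => w; rewrite level_visit_mx.
exact: (visit_mx_inj lam0_gt0 n2 irr free (level_towers l) (@level_sub l) (@level_saturated0 l)).
Qed.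

Lemma left_end_dom l (i : 'I_n) : 0 <= e l i < L.
Proof. by rewrite -hull0E; apply: level_sub; exact: left_end_hull (level_towers l) i. Qed.

(** A point of the larger interval outside of the smaller one lies on a higher
   floor of some tower, which therefore visits the larger interval twice. *)
Lemma visit_prod_neq1 k d : (0 < d)%N -> P k d <> 1%:M.
Proof.
move=> d0 P1.
have [x xk xnd] : exists2 x, hull (a k) (lam k) x & ~ hull (a (k + d)%N) (lam (k + d)%N) x.
  have [_ strict] : J k.+1 `<` J k by case: seqJ.
  apply: contrapT => no; apply: strict => y Jy; apply: contrapT => nJy; apply: no.
  exists y; first by rewrite -(sequence_hull seqJ).
  move=> hy; apply: nJy; rewrite (sequence_hull seqJ).
  case: d d0 hy {P1} => // d _; rewrite addnS -addSn; exact: level_nested.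
have xL : 0 <= x < L by rewrite -hull0E; exact: level_sub xk.
have twl := level_towers (k + d).
have [i [m [y [mh iy ymx]]]] := towers_cover lam0_gt0 n2 irr free twl (@level_sub (k + d)) xL.
have m0 : (0 < m)%N.
  rewrite lt0n; apply/negP => /eqP m0; apply: xnd; rewrite -ymx m0.
  by apply: piece_hull iy; exact: level_gt0.
have [j jx] := piece_cover xk; rewrite -ymx in jx.
have {}jx := (level_saturated j iy mh).1 jx.
have [j' j'e] := piece_cover (@level_nested k d _ (left_end_hull twl i)).
have h0 : (0 < h (k + d) i)%N by exact: ltn_trans mh.
have ent l : piece (a k) (lam k) l (e (k + d)%N i) \/
    piece (a k) (lam k) l (iter m T (e (k + d)%N i)) -> l = i.
  move=> hl; apply/eqP; apply: contrapT => /negP li.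
  have := congr1 (fun A : 'M_n => A l i) P1; rewrite level_visits mxE (negbTE li).
  move=> /eqP; rewrite pnatr_eq0 => /eqP v0.
  by case: hl => [/(@visits_gt0 _ T _ _ 0 _ h0)|/(visits_gt0 mh)]; rewrite v0.
have ji := ent j (or_intror jx); have j'i := ent j' (or_introl j'e); subst j j'.
have := congr1 (fun A : 'M_n => A i i) P1; rewrite level_visits mxE eqxx.
move=> /eqP; rewrite eqr_nat => /eqP v1.
by have := @visits_gt1 _ T _ _ 0 m _ m0 mh j'e jx; rewrite v1.
Qed.

Lemma heights_bounded (c d : R) : c < d ->
  (forall l x, c <= x < d -> hull (a l) (lam l) x) ->
  exists M, forall l i, (h l i <= M)%N.
Proof.
move=> cd sub.
have := level_sub (sub 0%N c _); rewrite lexx cd hull0E => /(_ isT)/andP[c0 cL].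
have dL : d <= L.
  rewrite leNgt; apply/negP => Ld; have := level_sub (sub 0%N L _).
  by rewrite hull0E ltxx andbF => H; apply: notF; apply: H; rewrite Ld ltW.
have [M HM] := keane_minimal kT c0 cd dL.
exists M.+1 => l i.
have [[m mM Km] _] := HM _ (keane_dom kT (left_end_dom l i)).
have [_ _ out] := towers_return (level_towers l) (piece_left _ (level_gt0 l) i).
rewrite leqNgt; apply/negP => Mh; apply: (out m.+1); first by rewrite /= (leq_trans _ Mh).
by rewrite iterSr; exact: sub.
Qed.

(** Otherwise the intervals contain a common one, which bounds the heights, hence
   the entries of A_l.  Two of these matrices then coincide, against
   [visit_prod_neq1]. *)
Lemma levels_shrink (delta : R) : 0 < delta -> exists l, e l n - a l < delta.
Proof.
move=> d0; apply: contrapT => no.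
have len l : delta <= e l n - a l by rewrite leNgt; apply/negP => h; apply: no; exists l.
have an l : a l < e l n by have := len l; lra.
have nest k d : a k <= a (k + d)%N /\ e (k + d)%N n <= e k n.
  have sub := @level_nested k d; have hl := an (k + d)%N; have hk := an k.
  have := sub (a (k + d)%N); rewrite !hullE lexx hl => /(_ isT)/andP[h1 h2]; split=> //.
  rewrite leNgt; apply/negP => h3; pose z := Num.max (a (k + d)%N) (e k n).
  have := sub z; rewrite !hullE /z le_max lexx gt_max hl h3 => /(_ isT)/andP[_].
  by rewrite gt_max ltxx andbF.
have cross k l : a k <= e l n - delta.
  have [kl|lk] := leqP k l.
    by have [+ _] := nest k (l - k)%N; rewrite subnKC// => h1; have := len l; lra.
  have [_] := nest l (k - l)%N; rewrite subnKC; last exact: ltnW.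
  by have := len k; lra.
pose c := sup (range a).
have ub l : a l <= c.
  by apply: ub_le_sup; [exists (e 0%N n - delta) => _ [k _ <-]; exact: cross|exists l].
have cu l : c <= e l n - delta.
  by apply: ge_sup; [exists (a 0%N); exists 0%N|move=> _ [k _ <-]; exact: cross].
have [||M hM] := @heights_bounded c (c + delta).
- lra.
- by move=> l x; rewrite hullE; have := ub l; have := cu l; lra.
pose f l : {ffun 'I_n * 'I_n -> 'I_M.+1} :=
  [ffun ij : 'I_n * 'I_n => inord (visits T (piece (a 0%N) (lam 0%N) ij.1) (e l ij.2) (h l ij.2))].
have fE l : P 0%N l = \matrix_(i, j) (f l (i, j))%:R.
  apply/matrixP => i j; rewrite level_visits mxE ffunE inordK//= ltnS.
  exact: leq_trans (visits_le _ _ _ _) (hM l j).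
have [l [l' [ll' ff]]] := @seq_pigeonhole _ (enum {ffun 'I_n * 'I_n -> 'I_M.+1}) f
  (fun l => mem_enum _ _).
have PP : P 0%N l' = P 0%N l by rewrite !fE ff.
have := visit_prodD R B 0 l (l' - l); rewrite subnKC ?(ltnW ll')// add0n PP => /esym E.
apply: (@visit_prod_neq1 l (l' - l)); first by rewrite subn_gt0.
by rewrite -[LHS](mulKmx (visit_prod_unit l)) E mulVmx// visit_prod_unit.
Qed.

Lemma tower_displacement l (i : 'I_n) :
  iter (h l i) T (e l i) - e l i = \sum_j iet_shift pi lam0 j * P 0%N l j i.
Proof.
rewrite level_visit_mx.
rewrite -(sum_visits lam0_gt0 (iet_hull pi lam0_gt0) (level_towers l) (@level_sub l)
  (g := fun m => iter m.+1 T (e l i) - iter m T (e l i))).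
  by elim: (h l i) => [|m IH]; [rewrite big_ord0 subrr|rewrite big_ord_recr /= -IH; ring].
move=> j m _ jm; rewrite iterS (iet_on_piece pi lam0_gt0 jm).
have -> : iet_shift pi lam0 j = endpoint 0 (image_lengths pi lam0) (pi j) - endpoint 0 lam0 j.
  by rewrite endpoint_image /iet_shift /endpoint add0r.
ring.
Qed.

Lemma heights_mono k d i : exists j, (h k j <= h (k + d) i)%N.
Proof.
have twl := level_towers (k + d); have eJ := left_end_hull twl i.
have [j je] := piece_cover (level_nested eJ); exists j.
have [_ _ out] := towers_return (level_towers k) je.
rewrite leqNgt; apply/negP => lt; apply: (out (h (k + d) i)).
  by rewrite lt (height_gt0 twl).
exact: level_nested (top_hull twl i).
Qed.

(** Towers of height at most M displace the base by finitely many amounts, nonzero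
   by aperiodicity, whereas the displacement is at most the length of the
   base. *)
Lemma heights_unbounded M : exists l, forall d i, (M < h (l + d) i)%N.
Proof.
suff [l hl] : exists l, forall i, (M < h l i)%N.
  exists l => d i; have [j jd] := heights_mono l d i.
  exact: leq_trans (hl j) jd.
apply: contrapT => no.
have short l : exists i, (h l i <= M)%N.
  apply: contrapT => no'; apply: no; exists l => i; rewrite ltnNge; apply/negP => hi.
  by apply: no'; exists i.
pose disp (c : {ffun 'I_n -> 'I_M.+1}) : R := \sum_j iet_shift pi lam0 j * (c j)%:R.
pose ds := [seq d <- 1 :: [seq `|disp c| | c <- enum {ffun 'I_n -> 'I_M.+1}] | 0 < d].
have [|delta] := @seq_has_min _ ds.
  by rewrite /ds /= ltr01.
rewrite mem_filter => /andP[d0 _] dmin.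
have [l ll] := levels_shrink d0; have [i hi] := short l.
have twl := level_towers l.
pose c : {ffun 'I_n -> 'I_M.+1} :=
  [ffun j : 'I_n => inord (visits T (piece (a 0%N) (lam 0%N) j) (e l i) (h l i))].
have cE : iter (h l i) T (e l i) - e l i = disp c.
  rewrite tower_displacement; apply: eq_bigr => j _; rewrite level_visits ffunE inordK//.
  by rewrite ltnS (leq_trans (visits_le _ _ _ _)).
have cn0 : disp c != 0.
  rewrite -cE subr_eq0; apply/eqP; have := height_gt0 twl i; case: (h l i) => // s _.
  exact: (keane_aperiodic kT (left_end_dom l i)).
have : delta <= `|disp c|.
  apply: dmin; rewrite mem_filter normr_gt0 cn0 inE; apply/orP; right.
  by apply: (map_f (fun c => `|disp c|)); rewrite mem_enum.
rewrite leNgt -cE => /negP; apply.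
have := top_hull twl i; have := left_end_hull twl i; rewrite !hullE => h1 h2.
by rewrite ltr_norml; apply/andP; split; lra.
Qed.

(** A tower higher than the hitting time of a piece visits that piece. *)
Theorem visit_prod_positive k : exists d0, forall d, (d0 <= d)%N ->
  forall i j, 1 <= P k d i j.
Proof.
have piece_hit (j : 'I_n) : exists M, forall x, 0 <= x < L ->
    exists2 m, (m <= M)%N & piece (a k) (lam k) j (iter m T x).
  have lt := endpoint_lt (a k) (level_gt0 k) (ltnSn j).
  have sub x : piece (a k) (lam k) j x -> 0 <= x < L.
    by move=> /(piece_hull (level_gt0 k))/level_sub; rewrite hull0E.
  have := sub (e k j); rewrite pieceE lexx lt => /(_ isT)/andP[c0 _].
  have dL : e k j.+1 <= L.
    rewrite leNgt; apply/negP => Ld; pose z := Num.max (e k j) L.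
    have := sub z; rewrite pieceE /z le_max lexx gt_max lt Ld => /(_ isT)/andP[_].
    by rewrite gt_max ltxx andbF.
  have [M HM] := keane_minimal kT c0 lt dL; exists M => x /HM[[m mM Km] _].
  by exists m => //; rewrite pieceE.
have [f fP] := choice piece_hit.
have [l hl] := heights_unbounded (\max_j f j).
exists l => d ld i j; rewrite level_visits ler1n.
have [m mf Km] := fP i _ (left_end_dom (k + d) j).
apply: visits_gt0 Km; apply: leq_ltn_trans mf _; apply: leq_ltn_trans (leq_bigmax i) _.
have -> : (k + d = l + (k + d - l))%N by rewrite subnKC// (leq_trans ld) ?leq_addl.
exact: hl.
Qed.

End MinimalInduction.

(** * Perron vectors of positive matrices *)

Section Perron.
Context (R : realType).

Lemma continuous_sum (T : topologicalType) (I : Type) (s : seq I) (F : I -> T -> R) :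
  (forall i, continuous (F i)) -> continuous (fun z => \sum_(i <- s) F i z).
Proof.
move=> Fc; elim: s => [|i s IH] z.
  under eq_fun do rewrite big_nil; exact: cvg_cst.
under eq_fun do rewrite big_cons.
by apply: continuousD; [exact: Fc|exact: IH].
Qed.

Lemma closed_nonneg (T : topologicalType) (f : T -> R) :
  continuous f -> closed [set z | 0 <= f z].
Proof.
move=> fc; apply: (@preimage_closed _ _ f [set x | 0 <= x]).
  by move=> z _; exact: fc.
exact: closed_ge.
Qed.

Lemma sub_scale_mxE (m p : nat) (A D : 'M[R]_(m, p)) c i j :
  (A - c *: D) i j = A i j - c * D i j.
Proof. by rewrite !mxE. Qed.

Context (n : nat) (C : 'M[R]_n) (C0 : forall i j, 0 < C i j).

Lemma pos_mulmx_gt0 (x : 'cV[R]_n) : (forall i, 0 <= x i 0) -> x != 0 ->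
  forall i, 0 < (C *m x) i 0.
Proof.
move=> x0 xn0 i; have [k xk] : exists k, x k 0 != 0.
  apply: contrapT => no; move/negP: xn0; apply; apply/eqP/matrixP => k o.
  rewrite (ord1 o) mxE; apply/eqP; apply: contrapT => /negP xk; apply: no; by exists k.
rewrite mxE (bigD1 k)//= ltr_pwDl//; first by rewrite mulr_gt0// lt_neqAle eq_sym xk x0.
by apply: sumr_ge0 => j _; rewrite mulr_ge0// ltW.
Qed.

(** The Perron value is the largest t such that C x >= t x for some x in the
   simplex; compactness of the simplex makes it attained. *)
Theorem perron_exists : (0 < n)%N -> exists theta (v : 'cV[R]_n),
  [/\ 0 < theta, forall i, 0 < v i 0 & C *m v = theta *: v].
Proof.
move=> n0; pose S := \sum_i \sum_j C i j.
pose xc (z : 'rV[R]_n.+1) : 'cV[R]_n := \col_i z 0 (lift ord0 i).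
pose f0 (z : 'rV[R]_n.+1) : R := z 0 ord0.
pose K := [set z : 'rV[R]_n.+1 | [/\ 0 <= f0 z, forall i, 0 <= xc z i 0,
  \sum_i xc z i 0 = 1 & forall i, f0 z * xc z i 0 <= (C *m xc z) i 0]].
have xle (x : 'cV[R]_n) : (forall i, 0 <= x i 0) -> \sum_i x i 0 = 1 -> forall i, x i 0 <= 1.
  by move=> x0 <- i; rewrite (bigD1 i)//= lerDl sumr_ge0.
have KS z : K z -> f0 z <= S.
  move=> [z0 x0 x1 zx]; rewrite -[f0 z]mulr1 -x1 mulr_sumr; apply: ler_sum => i _.
  apply: le_trans (zx i) _; rewrite mxE; apply: ler_sum => j _.
  by rewrite ler_piMr ?xle// ltW.
have xcc i : continuous (fun z => xc z i 0 : R).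
  have -> : (fun z => xc z i 0) = (fun z : 'rV[R]_n.+1 => z 0 (lift ord0 i)).
    by apply/funext => z; rewrite mxE.
  exact: coord_continuous.
have f0c : continuous f0 by exact: coord_continuous.
have Kclosed : closed K.
  have -> : K = [set z | 0 <= f0 z] `&`
      (\bigcap_(i in [set: 'I_n]) [set z | 0 <= xc z i 0]) `&`
      ([set z | 0 <= \sum_i xc z i 0 - 1] `&` [set z | 0 <= 1 - \sum_i xc z i 0]) `&`
      (\bigcap_(i in [set: 'I_n]) [set z | 0 <= (\sum_j C i j * xc z j 0) - f0 z * xc z i 0]).
    apply/seteqP; split=> z /=.
      move=> [z0 x0 x1 zx]; split; first (split; first by split=> // i _; exact: x0).
        by rewrite x1 subrr.
      by move=> i _ /=; have := zx i; rewrite [(C *m _) _ _]mxE subr_ge0.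
    move=> [[[z0 x0] [s1 s2]] zx]; split=> // [i||i]; first exact: x0.
      by apply/eqP; rewrite eq_le -subr_ge0 s2 -subr_ge0.
    by have := zx i I; rewrite /= subr_ge0 [(C *m _) _ _]mxE.
  have sumc : continuous (fun z => \sum_i xc z i 0) by exact: continuous_sum.
  apply: closedI; first apply: closedI; first apply: closedI.
  - exact: closed_nonneg.
  - by apply: closed_bigI => i _; exact: closed_nonneg.
  - apply: closedI; apply: closed_nonneg => z; apply: continuousB.
    + exact: (sumc z).
    + exact: cst_continuous.
    + exact: cst_continuous.
    + exact: (sumc z).
  - apply: closed_bigI => i _.
    have h1 : continuous (fun z => \sum_j C i j * xc z j 0).
      apply: (continuous_sum (F := fun j z => C i j * xc z j 0)) => j z.
      by apply: continuousM; [exact: cst_continuous|exact: xcc].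
    have h2 : continuous (fun z => f0 z * xc z i 0).
      by move=> z; exact: (continuousM (f0c z) (xcc i z)).
    apply: (@closed_nonneg _ (fun z => (\sum_j C i j * xc z j 0) - f0 z * xc z i 0)) => z.
    exact: (continuousB (h1 z) (h2 z)).
have Kcompact : compact K.
  pose M := 1 + `|S|.
  have box : compact [set v : 'rV[R]_n.+1 | forall i, `[0, M]%classic (v ord0 i)].
    exact: rV_compact (fun=> @segment_compact R 0 M).
  apply: (subclosed_compact Kclosed box) => z Kz i /=; have [z0 x0 x1 zx] := Kz; rewrite in_itv /=.
  case: (unliftP ord0 i) => [j|] ->.
    have := x0 j; have := xle _ x0 x1 j; rewrite mxE => h1 ->.
    by rewrite (le_trans h1)// /M lerDl.
  by rewrite z0 /= (le_trans (KS _ Kz))// /M (le_trans (ler_norm S))// lerDr.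
have pack t x : exists z, f0 z = t /\ xc z = x :> 'cV[R]_n.
  exists (\row_i if unlift ord0 i is Some j then x j 0 else t); split.
    by rewrite /f0 mxE unlift_none.
  by apply/matrixP => i o; rewrite !mxE liftK (ord1 o).
pose A := f0 @` K.
have Aclosed : closed A.
  apply: compact_closed; first exact: Rhausdorff.
  by apply: continuous_compact Kcompact; exact: continuous_subspaceT.
have K0 : K !=set0.
  pose i0 := Ordinal n0.
  have [z [z0 zx]] := pack 0 (\col_i (i == i0)%:R).
  exists z; split; rewrite ?z0 ?zx//.
  - by move=> i; rewrite mxE ler0n.
  - by rewrite (bigD1 i0)//= mxE eqxx big1 ?addr0// => i /negbTE ii; rewrite mxE ii.
  - move=> i; rewrite mul0r mxE sumr_ge0// => j _; rewrite mulr_ge0//; first exact: ltW.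
    by rewrite mxE ler0n.
have ubA : has_ubound A by exists S => _ [z Kz <-]; exact: KS.
have [z Kz zsup] : A (sup A).
  apply: Aclosed; apply: closure_sup => //; have [z Kz] := K0; by exists (f0 z); exists z.
have [z0 x0 x1 zx] := Kz; set th := f0 z in z0 zx zsup; set x := xc z in x0 x1 zx.
have xn0 : x != 0.
  apply/eqP => xe; move: x1; rewrite xe big1 => [/esym/eqP|i _]; last by rewrite mxE.
  by rewrite oner_eq0.
have Cx0 := pos_mulmx_gt0 x0 xn0.
have eig : C *m x = th *: x.
  apply: contrapT => neq; pose y := C *m x; pose d := y - th *: x.
  have d0 i : 0 <= d i 0 by rewrite sub_scale_mxE subr_ge0; exact: zx.
  have dn0 : d != 0 by rewrite subr_eq0; apply/eqP.
  have Cd0 := pos_mulmx_gt0 d0 dn0.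
  have Cy i : (C *m d) i 0 = (C *m y) i 0 - th * y i 0.
    by rewrite mulmxBr -scalemxAr sub_scale_mxE.
  have [|eps] := @seq_has_min R [seq (C *m d) i 0 / y i 0 | i <- enum 'I_n].
    by rewrite -size_eq0 size_map size_enum_ord -lt0n.
  move=> /mapP[i1 _ epsE] epsmin.
  have eps0 : 0 < eps by rewrite epsE divr_gt0.
  have epsle i : eps * y i 0 <= (C *m d) i 0.
    rewrite -ler_pdivlMr//; apply: epsmin.
    by apply: (map_f (fun i => (C *m d) i 0 / y i 0)); rewrite mem_enum.
  pose s := \sum_i y i 0.
  have s0 : 0 < s by rewrite /s (bigD1 (Ordinal n0))//= ltr_pwDl// sumr_ge0// => i _; exact: ltW.
  have [z' [z'0 z'x]] := pack (th + eps) (s^-1 *: y).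
  have : A (th + eps).
    exists z' => //; split; rewrite ?z'0 ?z'x.
    - by rewrite addr_ge0// ltW.
    - by move=> i; rewrite mxE mulr_ge0 ?invr_ge0 ?ltW.
    - under eq_bigr do rewrite mxE; by rewrite -mulr_sumr mulVf// gt_eqF.
    - move=> i; rewrite -scalemxAr [(s^-1 *: y) i 0]mxE [(s^-1 *: (C *m y)) i 0]mxE.
      rewrite mulrCA ler_pM2l ?invr_gt0//; have := epsle i; rewrite Cy; lra.
  by move=> /(ub_le_sup ubA); rewrite -zsup; lra.
exists th, x; have xgt0 i : 0 < x i 0.
  rewrite lt_neqAle x0 andbT; apply/negP => /eqP xi; have := Cx0 i.
  by rewrite eig mxE -xi mulr0 ltxx.
split=> //; have := Cx0 (Ordinal n0); rewrite eig mxE pmulr_lgt0//.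
Qed.

(** Subtract the largest multiple of v that keeps the difference nonnegative: it has
   a zero entry, which positivity of C forbids unless it vanishes. *)
Lemma perron_simple theta (v y : 'cV[R]_n) : (0 < n)%N ->
  (forall i, 0 < v i 0) -> C *m v = theta *: v -> C *m y = theta *: y ->
  exists c, y = c *: v.
Proof.
move=> n0 v0 Cv Cy.
have [|c] := @seq_has_min R [seq y i 0 / v i 0 | i <- enum 'I_n].
  by rewrite -size_eq0 size_map size_enum_ord -lt0n.
move=> /mapP[i0 _ cE] cmin; exists c.
pose z := y - c *: v.
have zE i : z i 0 = y i 0 - c * v i 0 by exact: sub_scale_mxE.
have z0 i : 0 <= z i 0.
  rewrite zE subr_ge0 -ler_pdivlMr//; apply: cmin.
  by apply: (map_f (fun i => y i 0 / v i 0)); rewrite mem_enum.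
have Cz : C *m z = theta *: z.
  by rewrite mulmxBr -scalemxAr Cv Cy scalerBr !scalerA mulrC.
apply/eqP; rewrite -subr_eq0; apply: contrapT => /negP zn0.
have := pos_mulmx_gt0 z0 zn0 i0; rewrite -/z Cz mxE zE cE divfK ?gt_eqF//.
by rewrite subrr mulr0 ltxx.
Qed.

End Perron.

(** * Orders of the images as permutations *)

Section Orders.
Context (n : nat).

(** Orders of the induced exchanges arise as relations; ranking them brings back
   permutations, which form a finite type. *)
Lemma strict_order_perm (N : rel 'I_n) : irreflexive N -> transitive N ->
  (forall i j, i != j -> N i j || N j i) -> exists s : 'S_n, N = perm_order s.
Proof.
move=> irr tr tot; pose rk i := #|[set k | N k i]%SET|.
have rkn i : (rk i < n)%N.
  rewrite -[ltnRHS]card_ord -cardsT; apply: proper_card; apply/properP.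
  by split; [exact: finset.subsetT|exists i; rewrite !inE// irr].
have rk_lt i j : N i j -> (rk i < rk j)%N.
  move=> ij; apply: proper_card; apply/properP; split.
    by apply/fintype.subsetP => k; rewrite !inE => /tr; apply.
  by exists i; rewrite !inE ?ij ?irr.
pose f i : 'I_n := Ordinal (rkn i).
have finj : injective f.
  move=> i j /(congr1 val) /= e; apply/eqP; apply: contraT => /tot/orP[]/rk_lt;
    by rewrite e ltnn.
exists (perm finj); apply/funext => i; apply/funext => j.
rewrite /perm_order !permE /=; apply/idP/idP => [/rk_lt//|].
have [->|ij] := eqVneq i j; first by rewrite ltnn.
by case/orP: (tot _ _ ij) => // /rk_lt; case: ltngtP.
Qed.

Lemma perm_order_inj : injective (@perm_order n).
Proof.
move=> s t st; have val_count (u : 'S_n) j : (\sum_(k < n) perm_order u k j)%N = u j.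
  rewrite (reindex_inj (@perm_inj _ u^-1)) /=.
  have widen := big_ord_widen n (fun=> 1%N) (ltnW (ltn_ord (u j))).
  transitivity (\sum_(i < n | (i < u j)%N) 1)%N; last by rewrite -widen sum1_card card_ord.
  rewrite [RHS]big_mkcond; apply: eq_bigr => k _; rewrite /perm_order permKV.
  by case: (_ < _)%N.
by apply/permP => j; apply: val_inj; rewrite /= -!val_count st.
Qed.

Context (R : realType).
Local Notation Om s := (translation_mx R (@perm_order n s)).

Lemma translation_mx_inj (s t : 'S_n) : Om s = Om t -> s = t.
Proof.
move=> e; apply: perm_order_inj; apply/funext => k; apply/funext => j.
have /eqP := congr1 (fun A : 'M_n => A j k) e.
rewrite !mxE (inj_eq (addIr _)) eqr_nat.
by do 2 case: perm_order.
Qed.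

Lemma translation_mx1 : Om 1%g = 0.
Proof. by apply/matrixP => i j; rewrite !mxE /perm_order !perm1 subrr. Qed.

Context (v : 'rV[R]_n) (v0 : positive_vector v).
Local Notation ga s := (endpoint 0 (image_lengths s v)).

Lemma translation_mx_row (s : 'S_n) i : (Om s *m v^T) i 0 = ga s (s i) - endpoint 0 v i.
Proof.
rewrite endpoint_image /endpoint add0r mxE [X in X - _]big_mkcond [X in _ - X]big_mkcond.
rewrite -sumrB; apply: eq_bigr => k _; rewrite !mxE mulrBl /perm_order.
by congr (_ - _); case: (_ < _)%N; rewrite ?mul1r ?mul0r.
Qed.

(** Adding the translations to the left ends of the pieces gives the left ends of
   the images, which come in the order of the images. *)
Lemma translation_mx_vec_inj (s t : 'S_n) : Om s *m v^T = Om t *m v^T -> s = t.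
Proof.
move=> e; apply: perm_order_inj; apply/funext => k; apply/funext => j.
have E i : ga s (s i) = ga t (t i).
  have := congr1 (fun A : 'cV_n => A i 0) e; rewrite !translation_mx_row.
  exact: addIr.
rewrite /perm_order -(endpoint_ltE 0 (image_lengths_gt0 s v0)) !E.
by rewrite (endpoint_ltE 0 (image_lengths_gt0 t v0)).
Qed.

Lemma telescope_endpoints (w : 'rV[R]_n) (f : R -> R) :
  \sum_(i < n) (f (endpoint 0 w i.+1) - f (endpoint 0 w i)) = f (endpoint 0 w n) - f 0.
Proof.
rewrite -[X in _ - f X](endpoint0 0 w).
suff H k : \sum_(i < k) (f (endpoint 0 w i.+1) - f (endpoint 0 w i)) =
  f (endpoint 0 w k) - f (endpoint 0 w 0) by exact: H.
elim: k => [|k IH]; first by rewrite big_ord0 subrr.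
by rewrite big_ord_recr /= IH; ring.
Qed.

(** The equation of a sphere through 0 in the norm weighted by v: the integral of
   x^2 over the whole interval is the sum of its integrals over the pieces, before
   and after the exchange. *)
Lemma translation_sphere (s : 'S_n) (w := Om s *m v^T) :
  \sum_(i < n) v 0 i * w i 0 * (w i 0 + 2 * endpoint 0 v i + v 0 i) = 0.
Proof.
pose cube (x : R) := x ^+ 3.
have h1 := telescope_endpoints v cube.
have h2 := telescope_endpoints (image_lengths s v) cube.
rewrite endpoint_image_total -h1 (reindex_inj (@perm_inj _ s)) /= in h2.
apply: (mulfI (x := 3)); first by rewrite pnatr_eq0.
rewrite mulr0 -[RHS](subrr (\sum_(i < n) (cube (endpoint 0 v i.+1) - cube (endpoint 0 v i)))).
rewrite -[X in _ = X - _]h2 -sumrB mulr_sumr; apply: eq_bigr => i _.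
rewrite (endpointS 0 v i) (endpointS 0 (image_lengths s v) (s i)) [image_lengths _ _ _ _]mxE permK.
rewrite /w translation_mx_row /cube; ring.
Qed.

(** A line through 0 meets the sphere in one further point. *)
Lemma translation_proportional (s t : 'S_n) c : t != 1%g -> s != 1%g ->
  Om s *m v^T = c *: (Om t *m v^T) -> s = t.
Proof.
move=> t1 s1 e; set w := Om t *m v^T in e.
have ne (u : 'S_n) : u != 1%g -> Om u *m v^T != 0.
  move=> u1; apply/eqP => u0; move/eqP: u1; apply; apply: translation_mx_vec_inj.
  by rewrite u0 translation_mx1 mul0mx.
have hs := translation_sphere s; rewrite e in hs.
have ht := translation_sphere t; rewrite -/w in ht.
pose sq := \sum_i v 0 i * (w i 0) ^+ 2.
have sq0 : 0 < sq.
  have [k wk] : exists k, w k 0 != 0.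
    apply: contrapT => no; move/negP: (ne t t1); apply; apply/eqP/matrixP => k o.
    rewrite (ord1 o) [RHS]mxE; apply/eqP; apply: contrapT => /negP wk; apply: no; by exists k.
  rewrite /sq (bigD1 k)//= ltr_pwDl//; first by rewrite mulr_gt0// exprn_even_gt0 ?wk ?orbT.
  by apply: sumr_ge0 => i _; rewrite mulr_ge0 ?sqr_ge0// ltW.
have : (c ^+ 2 - c) * sq = 0.
  rewrite -[RHS](subrr (0 : R)) -[X in _ = X - _]hs -[X in _ = _ - X](mulr0 c) -[X in _ = _ - c * X]ht.
  rewrite !mulr_sumr -sumrB; apply: eq_bigr => i _; rewrite [(c *: w) i 0]mxE; ring.
move/eqP; rewrite mulf_eq0 (gt_eqF sq0) orbF => /eqP cc.
have c0 : c != 0.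
  by apply/eqP => c0; move/eqP: (ne s s1); apply; rewrite e c0 scale0r.
have c1 : c = 1 by apply: (mulfI c0); rewrite mulr1 -expr2; apply/eqP; rewrite -subr_eq0 cc.
by apply: translation_mx_vec_inj; rewrite e c1 scale1r.
Qed.

End Orders.

(** * Two forms preserved by a positive matrix *)

Section InvariantForms.
Context (R : realType) (n : nat) (C : 'M[R]_n) (n2 : (2 <= n)%N).
Hypothesis C1 : forall i j, 1 <= C i j.
Context (A1 A2 : 'M[R]_n).
Hypotheses (inv1 : C^T *m A1 *m C = A1) (inv2 : C^T *m A2 *m C = A2).
Hypothesis ker1 : forall theta (u : 'cV[R]_n), 1 < theta ->
  A1 *m u = 0 -> C *m u = theta^-1 *: u -> u = 0.

Let n0 : (0 < n)%N := ltnW n2.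
Let C0 i j : 0 < C i j := lt_le_trans ltr01 (C1 i j).

Lemma perron_gt1 theta (v : 'cV[R]_n) :
  (forall i, 0 < v i 0) -> C *m v = theta *: v -> 1 < theta.
Proof.
move=> v0 Cv; pose i0 := Ordinal n0; pose i1 := Ordinal n2.
have := congr1 (fun A : 'cV_n => A i0 0) Cv; rewrite /= mxE [RHS]mxE => E.
rewrite -(ltr_pM2r (v0 i0)) mul1r -E (bigD1 i0)//= (bigD1 i1)//=.
have h1 := C1 i0 i0; have h2 := C1 i0 i1.
apply: (lt_le_trans (y := v i0 0 + v i1 0)); first by rewrite ltrDl.
apply: lerD; first by rewrite ler_peMl// ltW.
rewrite ler_wpDr ?ler_peMl ?(ltW (v0 _))//.
by apply: sumr_ge0 => j _; rewrite mulr_ge0 ?ltW.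
Qed.

Lemma perron_left_value theta theta' (v p : 'cV[R]_n) :
  (forall i, 0 < v i 0) -> (forall i, 0 < p i 0) ->
  C *m v = theta *: v -> C^T *m p = theta' *: p -> theta' = theta.
Proof.
move=> v0 p0 Cv Cp; have pv0 : (p^T *m v) 0 0 != 0.
  rewrite gt_eqF// mxE (bigD1 (Ordinal n0))//= ltr_pwDl ?mxE ?mulr_gt0//.
  by apply: sumr_ge0 => i _; rewrite mxE mulr_ge0 ?ltW.
apply: (mulIf pv0).
have e : (p^T *m C) *m v = p^T *m (C *m v) by rewrite mulmxA.
rewrite Cv -[C]trmxK -trmx_mul Cp -scalemxAr linearZ /= -scalemxAl in e.
by have := congr1 (fun A : 'M_1 => A 0 0) e; rewrite !mxE.
Qed.

(** Both A1 v and A2 v are eigenvectors of C^T for theta^-1, and this eigenspace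
   is a line: its dimension is that of the eigenspace of C, which A1 maps
   injectively into the line of left Perron vectors. *)
Theorem invariant_forms_proportional : exists v : 'cV[R]_n,
  (forall i, 0 < v i 0) /\ (A2 *m v != 0 -> exists c, A1 *m v = c *: (A2 *m v)).
Proof.
have [theta [v [th0 v0 Cv]]] := perron_exists C0 n0.
have CT0 i j : 0 < C^T i j by rewrite mxE.
have [theta' [p [_ p0 Cp]]] := perron_exists CT0 n0.
have {theta'}Cp : C^T *m p = theta *: p by rewrite -(perron_left_value v0 p0 Cv Cp).
have th1 := perron_gt1 v0 Cv.
have thn0 : theta != 0 by rewrite gt_eqF.
exists v; split=> // w20.
pose M := C - theta^-1%:M.
have kerE (x : 'rV[R]_n) (D : 'M[R]_n) :
    (x <= kermx (D - theta^-1%:M)^T)%MS -> D *m x^T = theta^-1 *: x^T.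
  move=> /sub_kermxP x0; have := congr1 trmx x0.
  rewrite trmx_mul trmxK trmx0 mulmxBl mul_scalar_mx => /eqP.
  by rewrite subr_eq0 => /eqP.
pose K := kermx M^T.
have KA : (K *m A1^T <= p^T)%MS.
  apply/row_subP => i; set x := row i K.
  have Cx : C *m x^T = theta^-1 *: x^T by apply: kerE; exact: row_sub.
  have : C^T *m (A1 *m x^T) = theta *: (A1 *m x^T).
    have := congr1 (fun A => A *m x^T) inv1; rewrite /= -!mulmxA Cx -!scalemxAr => E.
    by rewrite -[in RHS]E scalerA divff// scale1r.
  move=> /(perron_simple CT0 n0 p0 Cp)[c Ax].
  apply/sub_rVP; exists c; rewrite row_mul -/x.
  by apply: trmx_inj; rewrite trmx_mul trmxK Ax linearZ /= trmxK.
have K0 : (K :&: kermx A1^T)%MS = 0.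
  apply/eqP; rewrite -submx0; apply/row_subP => i; set x := row i _.
  have xK : (x <= K)%MS by apply: submx_trans (capmxSl _ _); exact: row_sub.
  have xA : (x <= kermx A1^T)%MS by apply: submx_trans (capmxSr _ _); exact: row_sub.
  have Ax : A1 *m x^T = 0.
    by apply: trmx_inj; rewrite trmx_mul trmxK trmx0; exact/sub_kermxP.
  by rewrite -[x]trmxK (ker1 th1 Ax (kerE _ _ xK)) trmx0 sub0mx.
have rK : (\rank K <= 1)%N.
  rewrite -(mxrank_mul_ker K A1^T) K0 mxrank0 addn0.
  exact: leq_trans (mxrankS KA) (rank_leq_row _).
have rM : (\rank (kermx M) <= 1)%N by move: rK; rewrite !mxrank_ker mxrank_tr.
have wM (A : 'M[R]_n) : C^T *m A *m C = A -> ((A *m v)^T <= kermx M)%MS.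
  move=> inv; have CA : C^T *m (A *m v) = theta^-1 *: (A *m v).
    have := congr1 (fun A => A *m v) inv; rewrite /= -!mulmxA Cv -!scalemxAr => E.
    by rewrite -[in RHS]E scalerA mulVf// scale1r.
  apply/sub_kermxP; rewrite /M mulmxBr mul_mx_scalar.
  by apply: trmx_inj; rewrite linearB /= trmx_mul trmxK CA linearZ /= trmxK subrr trmx0.
have w2M := wM _ inv2; have w1M := wM _ inv1.
have r2 : (0 < \rank (A2 *m v)^T)%N by rewrite lt0n mxrank_eq0 trmx_eq0.
have Mw2 : (kermx M <= (A2 *m v)^T)%MS.
  rewrite -(mxrank_leqif_sup w2M); rewrite eqn_leq mxrankS//=.
  exact: leq_trans rM r2.
have /sub_rVP[c E] := submx_trans w1M Mw2.
by exists c; apply: trmx_inj; rewrite E linearZ.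
Qed.

End InvariantForms.

(** * Comparison of the two exchanges *)

Section LevelForms.
Context (R : realType) (n : nat) (pi : 'S_n) (lam0 : 'rV[R]_n).
Hypotheses (lam0_gt0 : positive_vector lam0) (n2 : (2 <= n)%N).
Hypotheses (irr : irreducible_perm pi) (free : idoc pi lam0).
Local Notation T := (iet pi lam0).
Context (B : nat -> 'M[nat]_n) (J : nat -> set R) (a : nat -> R).
Context (lam : nat -> 'rV[R]_n) (r : nat -> 'I_n -> nat).
Hypotheses (a0 : a 0%N = 0) (lam_0 : lam 0%N = lam0).
Hypothesis seqJ : admissible_induction_sequence T J a lam r.
Hypothesis BE : forall k, B k.+1 = visitation_matrix (iterated_induced T J k)
  (a k) (lam k) (a k.+1) (lam k.+1) (r k.+1).

Local Notation h := (heights B).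
Local Notation P := (visit_prod R B).
Local Notation e l := (endpoint (a l) (lam l)).
Local Notation Om s := (translation_mx R (perm_order s)).

Let kT := idoc_keane lam0_gt0 n2 irr free.

Lemma irreducible_neq1 : pi != 1%g.
Proof.
apply/eqP => pi1; have n0 : (0 < n)%N by exact: ltnW.
by have := @irreducible_preimage0 n pi n2 irr (Ordinal n0); rewrite pi1 perm1 => /(_ erefl).
Qed.

Lemma level_form l : exists s : 'S_n, Om s = (P 0%N l)^T *m Om pi *m P 0%N l.
Proof.
have tw := level_towers lam0_gt0 a0 lam_0 seqJ BE l.
have sub := @level_sub _ _ _ _ J _ _ _ a0 lam_0 seqJ l.
have ldom := left_end_dom lam0_gt0 a0 lam_0 seqJ BE l.
have lam'0 := towers_gt0 tw.
have [|||s sE] := @strict_order_perm n (return_order T (a l) (lam l) (h l)).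
- by move=> i; rewrite /return_order ltxx.
- by move=> j i k; exact: lt_trans.
- have disj (i j : 'I_n) : (h l i <= h l j)%N ->
      iter (h l i) T (e l i) = iter (h l j) T (e l j) -> i = j.
    move=> hij eq; have := iter_cancel kT (ldom i) (ldom j) hij eq.
    have [hlt|] := ltnP (h l i) (h l j); last first.
      move=> hji; have -> : (h l j - h l i = 0)%N by apply/eqP; rewrite subn_eq0.
      move=> /= E; apply: (piece_uniq lam'0 (x := e l i)); first exact: piece_left.
      by rewrite E; exact: piece_left.
    move=> E; exfalso; apply: (@floor_outside _ _ _ _ _ _ tw j (h l j - h l i)).
      by rewrite subn_gt0 hlt ltn_subrL (height_gt0 tw) (height_gt0 tw).
    by rewrite -E; exact: (left_end_hull tw).
  move=> i j ij; rewrite /return_order -neq_lt; apply: contra_neq ij => eq.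
  by have [/disj/(_ eq)//|/ltnW/disj/(_ (esym eq))] := leqP (h l i) (h l j).
exists s; rewrite -sE (level_visit_mx lam0_gt0 a0 lam_0 seqJ BE).
have E := translation_mx_induced lam0_gt0 (@perm_order_irr n pi)
  (@iet_perm_lt _ _ pi _ lam0_gt0) (@iet_hull _ _ pi _ lam0_gt0) tw sub.
exact: esym E.
Qed.

(** The partial sums of a kernel vector are, up to a constant, the same at all
   levels, which leaves no room for an expansion by theta. *)
Lemma level_kernel_no_eigenvector k d (s : 'S_n) theta (u : 'cV[R]_n) :
  Om s = (P 0%N k)^T *m Om pi *m P 0%N k -> 1 < theta ->
  Om s *m u = 0 -> P k d *m u = theta^-1 *: u -> u = 0.
Proof.
move=> sE th su Pu; have unit_k := visit_prod_unit lam0_gt0 n2 irr free a0 lam_0 seqJ BE k.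
pose z := P 0%N k *m u.
have Omz : Om pi *m z = 0.
  have unitT : (P 0%N k)^T \in unitmx by rewrite unitmx_tr.
  have E : (P 0%N k)^T *m (Om pi *m z) = Om s *m u by rewrite sE !mulmxA.
  by rewrite -[LHS](mulKmx unitT) E su mulmx0.
suff z0 : z = 0 by rewrite -[u](mulKmx unit_k) -/z z0 mulmx0.
have partial l w : P 0%N l *m w = z -> exists c : R,
    (forall j : 'I_n, exists i : 'I_n, endpoint 0 z^T j = endpoint c w^T i) /\
    (forall i : 'I_n, exists j : 'I_n, endpoint c w^T i = endpoint 0 z^T j).
  rewrite (level_visit_mx lam0_gt0 a0 lam_0 seqJ BE) => wz.
  have tw := level_towers lam0_gt0 a0 lam_0 seqJ BE l.
  have sub := @level_sub _ _ _ _ J _ _ _ a0 lam_0 seqJ l.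
  have sat := @level_saturated0 _ _ _ _ lam0_gt0 _ _ _ _ _ a0 lam_0 seqJ BE l.
  have := @kernel_partial_sums _ _ _ _ lam0_gt0 n2 irr free _ _ _ tw sub sat w.
  by rewrite -mulmxA wz; apply.
have [c1 [zu _]] := partial k u erefl.
have [c2 [_ uz]] : exists c : R,
    (forall j : 'I_n, exists i : 'I_n, endpoint 0 z^T j = endpoint c (theta *: u)^T i) /\
    (forall i : 'I_n, exists j : 'I_n, endpoint c (theta *: u)^T i = endpoint 0 z^T j).
  apply: (partial (k + d)%N); rewrite visit_prodD -mulmxA -scalemxAr Pu scalerA.
  by rewrite mulfV ?scale1r// gt_eqF// (lt_trans ltr01).
pose U (i : 'I_n) := endpoint 0 u^T i.
have scaleU (i : 'I_n) : endpoint c2 (theta *: u)^T i = c2 + theta * U i.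
  rewrite endpoint_shift /U /endpoint !add0r mulr_sumr; congr (_ + _).
  by apply: eq_bigr => j _; rewrite !mxE.
have U1 (i : 'I_n) : endpoint c1 u^T i = c1 + U i by exact: endpoint_shift.
have pull i : exists i', c2 + theta * U i = c1 + U i'.
  have [j E] := uz i; have [i' E'] := zu j.
  by exists i'; rewrite -scaleU E E' U1.
have n0 : (0 < n)%N by exact: ltnW.
pose i0 := Ordinal n0.
(* mu is the least difference of two partial sums, and theta * mu is again a
   difference of two partial sums. *)
have [|mu] := @seq_has_min R [seq U i - U j | i <- enum 'I_n, j <- enum 'I_n].
  have : U i0 - U i0 \in [seq U i - U j | i <- enum 'I_n, j <- enum 'I_n].
    by apply/allpairsP; exists (i0, i0); rewrite !mem_enum.
  by case: [seq _ | _ <- _, _ <- _].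
move=> /allpairsP[[i j] /= [_ _ muE]] mumin.
have mule i' j' : mu <= U i' - U j'.
  by apply: mumin; apply/allpairsP; exists (i', j'); rewrite !mem_enum.
have mu0 : 0 <= mu.
  have [i' Ei] := pull i; have [j' Ej] := pull j.
  have := mule i' j'; have -> : U i' - U j' = theta * mu by rewrite muE; lra.
  by rewrite -{1}[mu]mul1r -subr_ge0 -mulrBl pmulr_rge0// subr_gt0.
have Uconst i' : U i' = 0.
  have : U i0 = 0 by rewrite /U endpoint0.
  by have := mule i' i0; have := mule i0 i'; lra.
have zc (j' : 'I_n) : endpoint 0 z^T j' = c1.
  by have [i' ->] := zu j'; rewrite U1 Uconst addr0.
apply: (@kernel_endpoints_const R n pi) => // j'.
by rewrite (zc j') -(zc i0) endpoint0.
Qed.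

End LevelForms.

Theorem theorem2 (R : realType) (n : nat) (pi rho : 'S_n)
    (lambda mu : 'rV[R]_n) (B : nat -> 'M[nat]_n) :
  (2 <= n)%N ->
  irreducible_perm pi -> irreducible_perm rho ->
  positive_vector lambda -> positive_vector mu ->
  idoc pi lambda -> idoc rho mu ->
  defines_visitation_matrices pi lambda B ->
  defines_visitation_matrices rho mu B ->
  pi = rho.
Proof.
move=> n2 irr irr' lam_gt0 mu_gt0 free free'.
move=> [J [a [lam [r [a0 lam_0 seqJ BE]]]]] [J' [a' [mu' [r' [a'0 mu_0 seqJ' BE']]]]].
pose P := visit_prod R B.
have [sg sgE] := choice (level_form lam_gt0 n2 irr free a0 lam_0 seqJ BE).
have [tu tuE] := choice (level_form mu_gt0 n2 irr' free' a'0 mu_0 seqJ' BE').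
have [d0 d0P] := choice (visit_prod_positive lam_gt0 n2 irr free a0 lam_0 seqJ BE).
(* The levels g s are so far apart that the product of the matrices between any
   two of them is positive. *)
pose g := fix g s := if s is s'.+1 then (g s' + (d0 (g s')).+1)%N else 0%N.
have g_far s s' : (s < s')%N -> (g s + d0 (g s) <= g s')%N.
  elim: s' => // s' IH; rewrite ltnS leq_eqVlt => /orP[/eqP->|/IH h] /=.
    by rewrite leq_add2l.
  by apply: leq_trans h _; rewrite leq_addr.
have [s [s' [ss' []]]] := @seq_pigeonhole _ (enum {: 'S_n * 'S_n})
  (fun s => (sg (g s), tu (g s))) (fun s => mem_enum _ _).
have [d gd] : exists d, g s' = (g s + d)%N.
  by exists (g s' - g s)%N; rewrite subnKC// (leq_trans _ (g_far _ _ ss'))// leq_addr.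
have dd0 : (d0 (g s) <= d)%N by have := g_far _ _ ss'; rewrite gd leq_add2l.
rewrite gd; set k := g s in dd0 * => sgk tuk.
pose C := P k d.
have C1 i j : 1 <= C i j by exact: d0P.
have inv (A : 'M[R]_n) (u u' : 'S_n) : u = u' ->
    translation_mx R (perm_order u) = (P 0%N k)^T *m A *m P 0%N k ->
    translation_mx R (perm_order u') = (P 0%N (k + d)%N)^T *m A *m P 0%N (k + d)%N ->
    C^T *m translation_mx R (perm_order u) *m C = translation_mx R (perm_order u).
  move=> <- E; rewrite /P visit_prodD add0n trmx_mul => E'.
  by rewrite [RHS]E' {1}E !mulmxA.
have inv1 := inv _ _ _ sgk (sgE k) (sgE (k + d)%N).
have inv2 := inv _ _ _ tuk (tuE k) (tuE (k + d)%N).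
have ker1 theta (u : 'cV[R]_n) : 1 < theta ->
    translation_mx R (perm_order (sg k)) *m u = 0 -> C *m u = theta^-1 *: u -> u = 0.
  exact: (level_kernel_no_eigenvector lam_gt0 n2 irr free a0 lam_0 seqJ BE (sgE k)).
have [v [v0 prop]] := invariant_forms_proportional n2 C1 inv1 inv2 ker1.
have Punit : P 0%N k \in unitmx by exact: (visit_prod_unit lam_gt0 n2 irr free a0 lam_0 seqJ BE k).
have form_inj (A A' : 'M[R]_n) :
    (P 0%N k)^T *m A *m P 0%N k = (P 0%N k)^T *m A' *m P 0%N k -> A = A'.
  have PTunit : (P 0%N k)^T \in unitmx by rewrite unitmx_tr.
  by move=> /(can_inj (mulmxK Punit))/(can_inj (mulKmx PTunit)).
have level_neq1 (p u : 'S_n) : p != 1%g ->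
    translation_mx R (perm_order u) =
      (P 0%N k)^T *m translation_mx R (perm_order p) *m P 0%N k -> u != 1%g.
  move=> p1 uE; apply/eqP => u1; move: uE; rewrite u1 translation_mx1.
  rewrite -[in LHS](mul0mx _ (P 0%N k)) -[in LHS](mulmx0 _ (P 0%N k)^T).
  move=> /form_inj; rewrite -translation_mx1 => /translation_mx_inj/esym/eqP.
  by rewrite (negbTE p1).
have sg1 := level_neq1 _ _ (irreducible_neq1 n2 irr) (sgE k).
have tu1 := level_neq1 _ _ (irreducible_neq1 n2 irr') (tuE k).
have v0' : positive_vector v^T by move=> i; rewrite mxE.
have sgtu : sg k = tu k.
  have w20 : translation_mx R (perm_order (tu k)) *m v != 0.
    apply/eqP => w0; move/eqP: tu1; apply; apply: (translation_mx_vec_inj v0').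
    by rewrite trmxK w0 translation_mx1 mul0mx.
  have [c cE] := prop w20.
  by apply: (translation_proportional v0' tu1 sg1 (c := c)); rewrite trmxK.
apply: (@translation_mx_inj _ R); apply: form_inj.
by rewrite -(sgE k) -(tuE k) sgtu.
Qed.
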